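(* Let $\phi\in L^n(\mathbb{R}^n,\Lambda\mathbb{R}^n)$. Then $\mathcal{C}^\pm\phi\in BMO(\mathbb{R}^n,\Lambda\mathbb{R}^n)$ and $$\|\mathcal{C}^\pm\phi\|_{BMO}\le C_n^\pm\|\phi\|_{L^n}$$ for some constants $C_n^\pm$ depending only on $n$.
   Context: $\Lambda\mathbb{R}^n$ is the exterior algebra with induced inner product; for a vector $v$ and multivector $w$, $v\triangle w=v\lrcorner w+v\wedge w$ and $v\triangledown w=-v\lrcorner w+v\wedge w$, where $\langle v\lrcorner w_1,w_2\rangle=\langle w_1,v\wedge w_2\rangle$. For $\Phi\in C_0^\infty(\mathbb{R}^n,\Lambda\mathbb{R}^n)$ the Cauchy transforms are $$\mathcal{C}^+\Phi(x)=\frac{1}{\sigma_{n-1}}\int\frac{y-x}{|y-x|^n}\triangle\Phi(y)\,dy,\qquad \mathcal{C}^-\Phi(x)=\frac{1}{\sigma_{n-1}}\int\frac{x-y}{|x-y|^n}\triangledown\Phi(y)\,dy,$$ with $\sigma_{n-1}$ the area of $\mathbb{S}^{n-1}$. As elements of $BMO$ they are considered modulo additive constants; for $\phi\in L^n$ one sets $\mathcal{C}^+\phi(x)=\frac1{\sigma_{n-1}}\int_{\mathbb{R}^n}\big[\frac{y-x}{|y-x|^n}-\frac{y}{|y|^n}\chi_{\mathbb{R}^n\setminus B_1(0)}(y)\big]\triangle\phi(y)\,dy$, and analogously for $\mathcal{C}^-$. $\|f\|_{BMO}=\sup_B\frac1{|B|}\int_B|f-f_B|\,dx$ over all balls $B$,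 where $f_B$ is the mean of $f$ over $B$. *)

(* Defs.v *)
From HB Require Import structures.
From mathcomp Require Import all_boot all_order all_algebra.
From mathcomp Require Import all_classical all_reals all_analysis.

Set Implicit Arguments.
Unset Strict Implicit.
Unset Printing Implicit Defensive.

Import Order.TTheory GRing.Theory Num.Theory.
Import numFieldNormedType.Exports.

Local Open Scope classical_set_scope.
Local Open Scope ring_scope.

(* [measurableTypeR R] is [R] itself, with the Borel sigma-algebra on which
   [lebesgue_measure] is declared; tuples carry the product sigma-algebra. *)
Notation euclidean R n := (n.-tuple (measurableTypeR R)).

Section lebesgue_step.
Context {R : realType} {n : nat}.
Variable m : {sigma_finite_measure set (euclidean R n) -> \bar R}.

Definition cons_pair (p : measurableTypeR R * euclidean R n) :
  euclidean R n.+1 := [tuple of p.1 :: p.2].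

Lemma measurable_cons_pair : measurable_fun setT cons_pair.
Proof.
exact: (@measurable_cons _ _ _ (measurableTypeR R) fst n snd).
Qed.

Definition lebesgue_step : set (euclidean R n.+1) -> \bar R :=
  pushforward (@lebesgue_measure R \x m)%E cons_pair.

Let step0 : lebesgue_step set0 = 0%E.
Proof. by rewrite /lebesgue_step /pushforward preimage_set0 measure0. Qed.

Let step_ge0 A : (0 <= lebesgue_step A)%E.
Proof. by rewrite /lebesgue_step /pushforward; apply: measure_ge0. Qed.

Let mpre A : measurable A -> measurable (cons_pair @^-1` A).
Proof.
by move=> mA; rewrite -[X in measurable X]setTI; exact: measurable_cons_pair.
Qed.

Let step_sigma_additive : semi_sigma_additive lebesgue_step.
Proof.
move=> F mF tF mUF; rewrite /lebesgue_step /pushforward preimage_bigcup.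
apply: measure_semi_sigma_additive.
- by move=> k; exact: mpre.
- apply/trivIsetP => /= i j _ _ ij; rewrite -preimage_setI.
  by move/trivIsetP : tF => /(_ _ _ _ _ ij) ->//; rewrite preimage_set0.
- by rewrite -preimage_bigcup; exact: mpre.
Qed.

HB.instance Definition _ := isMeasure.Build _ _ _ lebesgue_step
  step0 step_ge0 step_sigma_additive.

Let step_sigma_finite : sigma_finite setT lebesgue_step.
Proof.
have /sigma_finiteP[F [TF ndF Foo]] := sigma_finiteT (@lebesgue_measure R).
have /sigma_finiteP[G [TG ndG Goo]] := sigma_finiteT m.
pose u (x : euclidean R n.+1) : measurableTypeR R * euclidean R n :=
  (thead x, [tuple of behead x]).
have mu : measurable_fun setT u.
  apply/measurable_fun_pair; first exact: measurable_tnth.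
  exact: measurable_behead.
have uK p : u (cons_pair p) = p.
  by case: p => a b; rewrite /u theadE; congr pair; exact/val_inj.
exists (fun k => u @^-1` (F k `*` G k)).
  rewrite -preimage_bigcup; apply/esym/seteqP; split => // x _ /=.
  have [i _ Fi] : (\bigcup_i F i) (u x).1 by rewrite -TF.
  have [j _ Gj] : (\bigcup_i G i) (u x).2 by rewrite -TG.
  exists (maxn i j) => //; split.
  - by move: (u x).1 Fi; exact/subsetPset/ndF/leq_maxl.
  - by move: (u x).2 Gj; exact/subsetPset/ndG/leq_maxr.
move=> k; have [mF Fk] := Foo k; have [mG Gk] := Goo k; split.
  by rewrite -[X in measurable X]setTI; apply: mu => //; exact: measurableX.
rewrite /lebesgue_step /pushforward (_ : _ @^-1` _ = F k `*` G k).
  by rewrite product_measure1E// lte_mul_pinfty// ge0_fin_numE.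
by apply/funext => p; exact: (congr1 (F k `*` G k) (uK p)).
Qed.

HB.instance Definition _ := Measure_isSigmaFinite.Build _ _ _ lebesgue_step
  step_sigma_finite.

End lebesgue_step.

(* n-dimensional Lebesgue measure, restricted to the Borel sets. *)
Fixpoint lebesgue_measure_n (R : realType) (n : nat) :
    {sigma_finite_measure set (euclidean R n) -> \bar R} :=
  if n is k.+1 then lebesgue_step (lebesgue_measure_n R k)
  else \d_ ([tuple] : euclidean R 0).

Lemma lebesgue_measure_n_box (R : realType) (n : nat)
    (A : 'I_n -> set (measurableTypeR R)) :
  (forall i, measurable (A i)) ->
  lebesgue_measure_n R n [set x | forall i, A i (tnth x i)] =
  (\prod_(i < n) lebesgue_measure (A i))%E.
Proof.
elim: n A => [|n IH] A mA.
  rewrite big_ord0/= diracE mem_set//=; by case.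
rewrite big_ord_recl/= -IH; last by move=> i; exact: mA.
rewrite -product_measure1E//; last first.
  rewrite (_ : [set x | _] =
      \bigcap_(i in [set: 'I_n]) ((fun x => tnth x i) @^-1` A (lift ord0 i))).
    apply: fin_bigcap_measurable => // i _; rewrite -[X in measurable X]setTI.
    exact: measurable_tnth.
  by apply/seteqP; split => x /= h i //=; exact: h.
rewrite /lebesgue_step /pushforward; congr product_measure1.
apply/seteqP; split => -[a b] /=.
  move=> h; split; first exact: (h ord0).
  by move=> i; move: (h (lift ord0 i)); rewrite tnthS.
move=> [h0 h] i; case: (unliftP ord0 i) => [j ->|-> //].
by rewrite tnthS.
Qed.

Section euclidean_space.
Context {R : realType} {n : nat}.
Implicit Types x y v : euclidean R n.

Definition vzero : euclidean R n := [tuple (0 : R) | _ < n].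

Definition vsub x y : euclidean R n := [tuple (tnth x i - tnth y i : R) | i < n].

Definition vscale (a : R) x : euclidean R n := [tuple (a * tnth x i : R) | i < n].

Definition vnorm x : R := Num.sqrt (\sum_(i < n) tnth x i ^+ 2).

Definition vball x (r : R) : set (euclidean R n) :=
  [set y | vnorm (vsub y x) < r].

(* The surface measure given by polar coordinates: [n] times the Lebesgue
   measure of the truncated cone over [A]. *)
Definition sphere_measure (A : set (euclidean R n)) : \bar R :=
  (n%:R%:E * lebesgue_measure_n R n
     [set x | (0 < vnorm x < 1)%R /\ A (vscale (vnorm x)^-1%R x)])%E.

Definition sphere_area : R := fine (sphere_measure [set x | vnorm x = 1]).

End euclidean_space.

(* A multivector is given by its coordinates in the orthonormal basis
   e_S = e_{i_1} /\ ... /\ e_{i_k}, S = {i_1 < ... < i_k}. *)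
Notation multivector R n := {ffun {set 'I_n} -> R}.

Section exterior_algebra.
Context {R : realType} {n : nat}.
Implicit Types (S T U : {set 'I_n}) (w : multivector R n) (v : euclidean R n).

(* For disjoint S and T, e_S /\ e_T = shuffle_sign S T * e_(S :|: T): the
   exponent counts the inversions of the concatenation of S and T. *)
Definition shuffle_sign S T : R :=
  (-1) ^+ #|[pred p : 'I_n * 'I_n |
              [&& p.1 \in S, p.2 \in T & (p.2 < p.1)%N]]|.

Definition wedge w1 w2 : multivector R n :=
  [ffun U : {set 'I_n} => \sum_(S : {set 'I_n} | S \subset U)
     shuffle_sign S (U :\: S) * w1 S * w2 (U :\: S)].

Definition mv_basis S : multivector R n := [ffun T => (T == S)%:R].

Definition mv_of_vec v : multivector R n :=
  [ffun S : {set 'I_n} => \sum_(i < n | S == finset.set1 i) tnth v i].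

Definition mv_inner w1 w2 : R := \sum_(S : {set 'I_n}) w1 S * w2 S.

Definition mv_norm w : R := Num.sqrt (mv_inner w w).

(* The S-coordinate of the interior product is <v _| w, e_S>, which
   adjointness prescribes to be <w, v /\ e_S>. *)
Definition interior v w : multivector R n :=
  [ffun S => mv_inner w (wedge (mv_of_vec v) (mv_basis S))].

Lemma interior_adjoint v w1 w2 :
  mv_inner (interior v w1) w2 = mv_inner w1 (wedge (mv_of_vec v) w2).
Proof.
rewrite /mv_inner.
under eq_bigr => S _ do rewrite ffunE /mv_inner big_distrl/=.
rewrite exchange_big/=; apply: eq_bigr => U _.
under eq_bigr => S _ do rewrite -mulrA.
rewrite -big_distrr/=; congr (_ * _); rewrite ffunE.
under eq_bigr => S _ do rewrite ffunE big_distrl/=.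
rewrite exchange_big/=; apply: eq_bigr => T TU.
rewrite (bigD1 (U :\: T))//= big1 ?addr0.
  by rewrite [mv_basis _ _]ffunE eqxx mulr1.
by move=> S ST; rewrite [mv_basis _ _]ffunE eq_sym (negbTE ST) mulr0 mul0r.
Qed.

Definition vtriangle v w : multivector R n :=
  interior v w + wedge (mv_of_vec v) w.

Definition vtriangledown v w : multivector R n :=
  - interior v w + wedge (mv_of_vec v) w.

End exterior_algebra.

Section function_spaces.
Context {R : realType} {n : nat}.
Implicit Type f : euclidean R n -> multivector R n.

Local Notation mu := (lebesgue_measure_n R n).

Definition mv_integral (D : set (euclidean R n)) f : multivector R n :=
  [ffun S => \int[mu]_(x in D) f x S].

Definition mv_integrable (D : set (euclidean R n)) f : Prop :=
  forall S, mu.-integrable D (fun x => (f x S)%:E).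

Definition Lp_norm (p : \bar R) f : \bar R :=
  Lnorm mu p (fun x => (mv_norm (f x))%:E).

(* Functions rather than classes of functions equal almost everywhere. *)
Definition in_Lp (p : \bar R) f : Prop :=
  (forall S, measurable_fun setT (fun x => f x S)) /\ (Lp_norm p f < +oo)%E.

Definition mean (B : set (euclidean R n)) f : multivector R n :=
  [ffun S => (fine (mu B))^-1 * mv_integral B f S].

Definition BMO_norm f : \bar R :=
  ereal_sup [set ((fine (mu (vball c r)))^-1%:E *
      \int[mu]_(x in vball c r) (mv_norm (f x - mean (vball c r) f))%:E)%E
    | c in [set: euclidean R n] & r in [set r : R | 0 < r]].

(* Integrability on all balls is local integrability on R^n. *)
Definition in_BMO f : Prop :=
  (forall c r, mv_integrable (vball c r) f) /\ (BMO_norm f < +oo)%E.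

End function_spaces.

Section cauchy_transform.
Context {R : realType} {n : nat}.
Variable phi : euclidean R n -> multivector R n.
Implicit Types x y z : euclidean R n.

Local Notation mu := (lebesgue_measure_n R n).

Definition cauchy_kernel z : euclidean R n := vscale (vnorm z ^- n) z.

Definition cauchy_cutoff y : R := \1_(~` vball vzero 1) y.

Definition cauchy_plus_integrand x y : multivector R n :=
  vtriangle
    (vsub (cauchy_kernel (vsub y x)) (vscale (cauchy_cutoff y) (cauchy_kernel y)))
    (phi y).

(* The subtracted term is the value of the kernel at x = 0, as for C^+. *)
Definition cauchy_minus_integrand x y : multivector R n :=
  vtriangledown
    (vsub (cauchy_kernel (vsub x y))
          (vscale (cauchy_cutoff y) (cauchy_kernel (vsub vzero y))))
    (phi y).

Definition cauchy_plus x : multivector R n :=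
  [ffun S => (sphere_area (R := R) (n := n))^-1 *
             mv_integral setT (cauchy_plus_integrand x) S].

Definition cauchy_minus x : multivector R n :=
  [ffun S => (sphere_area (R := R) (n := n))^-1 *
             mv_integral setT (cauchy_minus_integrand x) S].

End cauchy_transform.

(* Main.v *)
Require Import Defs.
From HB Require Import structures.
From mathcomp Require Import all_boot all_order all_algebra.
From mathcomp Require Import all_classical all_reals all_analysis.
From mathcomp Require Import measurable_realfun ring lra.

Set Implicit Arguments.
Unset Strict Implicit.
Unset Printing Implicit Defensive.

Import Order.TTheory GRing.Theory Num.Theory.
Import numFieldNormedType.Exports.

Local Open Scope classical_set_scope.
Local Open Scope ring_scope.

(* On a ball B(c, r), changing the subtracted kernel to the restriction of
   K(y - c) to the complement of B(c, 2r) alters the transform by a constant.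
   The new kernel is K(y - x) for y in B(c, 2r), where Tonelli and the local
   integrability of |z|^(1-n) apply, and is O(r / |y - c|^n) for y outside.
   Splitting into dyadic balls, each estimate only needs the bounds
   |B(c, rho)| <= (2 rho)^n and int_B(c, rho) |phi| <= C rho^(n-1) ||phi||_n, so
   the mean distance of the transform to a constant on B(c, r) is O(||phi||_n).
   Both products of the exterior algebra enter only through their being
   bilinear, so that one estimate covers C^+ and C^-. *)

(** * The Euclidean norm *)

(** For [n > 1] Hölder's inequality fails here by a logarithm: the exponent dual to [n] turns
    |z|^(1-n) into |z|^(-n), which is integrable neither at the origin nor at infinity. The two ends
    need different cures. At infinity the subtraction gains one power of decay. At the singularity
    no bound is available for an individual x, and one appears only after integrating over x in the
    ball. So the integral defining the transform is known to converge only for almost every x, and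
    its comparison with the majorant is made almost everywhere. The resulting bound on a ball
    carries the factor r^n, which division by |B(c, r)| cancels; this makes the estimate uniform
    over balls. The bounds are stated for any M > 0 with M >= ||phi||_n, because they truncate |phi|
    at the positive level M / rho; letting M tend to the norm at the end also covers a field of norm
    zero. *)

Section sums_of_squares.
Context {R : realType} {I : finType}.
Implicit Types a b : I -> R.

Lemma sum_mul_le_sqrt a b :
  \sum_i a i * b i <= Num.sqrt (\sum_i a i ^+ 2) * Num.sqrt (\sum_i b i ^+ 2).
Proof.
have sq_ge0 a' : 0 <= \sum_i a' i ^+ 2 by apply: sumr_ge0 => i _; exact: sqr_ge0.
apply: le_trans (ler_norm _) _; rewrite -sqrtrM// -sqrtr_sqr ler_wsqrtr//.
rewrite -subr_ge0.
(* Lagrange's identity: the defect in Cauchy-Schwarz is half the sum of the squared minors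
   [a i * b j - a j * b i]. *)
suff -> : (\sum_i a i ^+ 2) * (\sum_i b i ^+ 2) - (\sum_i a i * b i) ^+ 2 =
    2^-1 * \sum_i \sum_j (a i * b j - a j * b i) ^+ 2.
  rewrite mulr_ge0// ?invr_ge0//; apply: sumr_ge0 => i _.
  by apply: sumr_ge0 => j _; exact: sqr_ge0.
have E : \sum_i \sum_j (a i * b j - a j * b i) ^+ 2 =
   \sum_i \sum_j (a i ^+ 2 * b j ^+ 2) + \sum_i \sum_j (a j ^+ 2 * b i ^+ 2)
   - 2 * \sum_i \sum_j ((a i * b i) * (a j * b j)).
  rewrite mulr_sumr -big_split/= -sumrB; apply: eq_bigr => i _.
  rewrite mulr_sumr -big_split/= -sumrB; apply: eq_bigr => j _.
  by ring.
rewrite E [X in _ + X - _]exchange_big/= expr2 !big_distrlr/=.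
by field.
Qed.

Lemma sqrt_sumD_le a b :
  Num.sqrt (\sum_i (a i + b i) ^+ 2) <=
  Num.sqrt (\sum_i a i ^+ 2) + Num.sqrt (\sum_i b i ^+ 2).
Proof.
have sq_ge0 a' : 0 <= \sum_i a' i ^+ 2 by apply: sumr_ge0 => i _; exact: sqr_ge0.
rewrite -[leRHS]ger0_norm ?addr_ge0// -sqrtr_sqr ler_wsqrtr// sqrrD !sqr_sqrtr//.
under eq_bigr do rewrite sqrrD.
rewrite !big_split/= lerD2r lerD2l.
by have := sum_mul_le_sqrt a b; lra.
Qed.

Lemma sqrt_sum_sqr_le a : Num.sqrt (\sum_i a i ^+ 2) <= \sum_i `|a i|.
Proof.
have ge0 : 0 <= \sum_i `|a i| by exact: sumr_ge0.
rewrite -[leRHS]ger0_norm// -sqrtr_sqr ler_wsqrtr// expr2 big_distrlr/=.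
apply: ler_sum => i _; rewrite (bigD1 i)//= -normrM -expr2.
by rewrite ger0_norm ?sqr_ge0// lerDl sumr_ge0// => j _; rewrite mulr_ge0.
Qed.

Lemma ler_sqrt_sum_sqr a i : `|a i| <= Num.sqrt (\sum_i a i ^+ 2).
Proof.
rewrite -sqrtr_sqr ler_wsqrtr// (bigD1 i)//= lerDl sumr_ge0// => j _.
exact: sqr_ge0.
Qed.

End sums_of_squares.

Section euclidean_norm.
Context {R : realType} {n : nat}.
Implicit Types x y z u v : euclidean R n.

Lemma vnorm_ge0 v : 0 <= vnorm v. Proof. exact: sqrtr_ge0. Qed.

Lemma tnth_vsub x y i : tnth (vsub x y) i = tnth x i - tnth y i :> R.
Proof. by rewrite tnth_mktuple. Qed.

Lemma tnth_vscale (a : R) x i : tnth (vscale a x) i = a * tnth x i :> R.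
Proof. by rewrite tnth_mktuple. Qed.

Lemma ler_tnth_vnorm v i : `|tnth v i : R| <= vnorm v.
Proof. exact: (ler_sqrt_sum_sqr (fun i => tnth v i : R)). Qed.

Lemma vnorm_le_sum v : vnorm v <= \sum_i `|tnth v i : R|.
Proof. exact: (sqrt_sum_sqr_le (fun i => tnth v i : R)). Qed.

Lemma vdistC x y : vnorm (vsub x y) = vnorm (vsub y x).
Proof.
rewrite /vnorm; congr Num.sqrt; apply: eq_bigr => i _.
by rewrite !tnth_vsub -sqrrN opprB.
Qed.

Lemma vdist_triangle y x z :
  vnorm (vsub x z) <= vnorm (vsub x y) + vnorm (vsub y z).
Proof.
rewrite {1}/vnorm.
under eq_bigr => i _.
  rewrite (_ : tnth _ i = (tnth (vsub x y) i : R) + tnth (vsub y z) i); last first.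
    by rewrite !tnth_vsub addrA subrK.
  over.
exact: (sqrt_sumD_le (fun i => tnth (vsub x y) i : R)
                     (fun i => tnth (vsub y z) i : R)).
Qed.

Lemma vsubx0 x : vsub x vzero = x.
Proof. by apply: eq_from_tnth => i; rewrite tnth_vsub tnth_mktuple subr0. Qed.

Lemma vsub_sub2l x y z : vsub (vsub z x) (vsub z y) = vsub y x.
Proof.
apply: eq_from_tnth => i.
by rewrite !tnth_vsub opprB [LHS]addrC -addrA [_ + (_ - _)]addrA addNr sub0r.
Qed.

Lemma vnorm_le_distD u v : vnorm u <= vnorm (vsub u v) + vnorm v.
Proof. by have := vdist_triangle v u vzero; rewrite !vsubx0. Qed.

Lemma ler_dist_vnorm u v : `|vnorm u - vnorm v| <= vnorm (vsub u v).
Proof.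
have := vnorm_le_distD u v; have := vnorm_le_distD v u; rewrite (vdistC v u).
by rewrite ler_norml => ? ?; apply/andP; split; lra.
Qed.

End euclidean_norm.

(** * Pointwise bounds on the Cauchy kernel *)

Section cauchy_kernel_bounds.
Context {R : realType} {n : nat}.
Implicit Types u v z : euclidean R n.

(** Factor out [a - b]; each of the [m] terms of the cofactor is at most [M ^ (m - 1)]. *)
Lemma ler_dist_exp (m : nat) (a b M : R) : 0 <= a <= M -> 0 <= b <= M ->
  `|a ^+ m - b ^+ m| <= `|a - b| * (m%:R * M ^+ m.-1).
Proof.
move=> /andP[a0 aM] /andP[b0 bM]; rewrite subrXX normrM ler_wpM2l//.
apply: le_trans (ler_norm_sum _ _ _) _.
have M0 := le_trans a0 aM.
apply: (@le_trans _ _ (\sum_(i < m) M ^+ m.-1)); last first.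
  by rewrite sumr_const card_ord mulr_natl.
apply: ler_sum => i _; rewrite normrM !normrX !ger0_norm//.
have -> : m.-1 = (m.-1 - i + i)%N.
  by rewrite subnK// -ltnS prednK// (leq_ltn_trans _ (ltn_ord i)).
rewrite exprD; apply: ler_pM; rewrite ?exprn_ge0// ?addnK.
  by rewrite lerXn2r// nnegrE.
by rewrite lerXn2r// nnegrE.
Qed.

Lemma cauchy_kernel_le z i :
  `|tnth (cauchy_kernel z) i : R| <= vnorm z / vnorm z ^+ n.
Proof.
rewrite tnth_vscale normrM ger0_norm ?invr_ge0 ?exprn_ge0 ?vnorm_ge0//.
by rewrite mulrC ler_wpM2r ?ler_tnth_vnorm// invr_ge0 exprn_ge0// vnorm_ge0.
Qed.

Lemma cauchy_kernel_dist_le u v i : 0 < vnorm v ->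
  vnorm (vsub u v) <= vnorm v / 2 ->
  `|tnth (cauchy_kernel u) i - tnth (cauchy_kernel v) i : R| <=
  n.+1%:R * 4 ^+ n * (vnorm (vsub u v) / vnorm v ^+ n).
Proof.
move=> v0 uv; rewrite !tnth_vscale.
set a := vnorm u; set b := vnorm v in v0 uv *; set d := vnorm (vsub u v) in uv *.
have d0 : 0 <= d by exact: vnorm_ge0.
have abd : `|a - b| <= d by exact: ler_dist_vnorm.
have [ab1 ab2] : b / 2 <= a /\ a <= 2 * b.
  by move: abd; rewrite ler_norml => /andP[? ?]; split; lra.
have a0 : 0 < a by lra.
have an0 : 0 < a ^+ n by rewrite exprn_gt0.
have bn0 : 0 < b ^+ n by rewrite exprn_gt0.
have aV : a ^- n <= 2 ^+ n * b ^- n.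
  rewrite -[2 ^+ n]invrK -invfM lef_pV2 ?posrE ?mulr_gt0 ?invr_gt0 ?exprn_gt0//.
  rewrite (_ : _ * _ = (b / 2) ^+ n); last by rewrite exprMn exprVn mulrC.
  by rewrite lerXn2r ?nnegrE; lra.
(* Inserting [a ^- n * tnth v i] separates the change of the vector from the change of its weight.
   The first term costs [2 ^ n], the second [n * 2 ^ (2n - 1)]; together they stay below
   [(n + 1) * 4 ^ n]. *)
have -> : a ^- n * tnth u i - b ^- n * tnth v i =
   a ^- n * tnth (vsub u v) i + tnth v i * (a ^- n * b ^- n * (b ^+ n - a ^+ n)).
  rewrite tnth_vsub; field.
  by rewrite !expf_neq0 ?gt_eqF.
apply: le_trans (ler_normD _ _) _.
rewrite -[in leRHS]natr1 [in leRHS]mulrDl mul1r mulrDl [leRHS]addrC lerD//.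
  rewrite normrM gtr0_norm ?invr_gt0// [d / _]mulrC mulrA.
  apply: ler_pM => //; first by rewrite invr_ge0 ltW.
    apply: (le_trans aV); rewrite ler_wpM2r ?invr_ge0 ?(ltW bn0)//.
    by rewrite lerXn2r ?nnegrE//; lra.
  exact: ler_tnth_vnorm.
rewrite !normrM (@gtr0_norm _ (a ^- n)) ?invr_gt0// (@gtr0_norm _ (b ^- n)) ?invr_gt0//.
rewrite distrC.
have Hp : `|a ^+ n - b ^+ n| <= d * (n%:R * (2 * b) ^+ n.-1).
  apply: (le_trans (ler_dist_exp n (M := 2 * b) _ _)).
  - by apply/andP; split; lra.
  - by apply/andP; split; lra.
  - by rewrite ler_wpM2r// mulr_ge0// exprn_ge0//; lra.
apply: (@le_trans _ _ (b * (2 ^+ n * b ^- n * b ^- n * (d * (n%:R * (2 * b) ^+ n.-1))))).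
  apply: ler_pM => //; rewrite ?ler_tnth_vnorm// ?mulr_ge0// ?invr_ge0 ?(ltW an0) ?(ltW bn0)//.
  apply: ler_pM => //; rewrite ?mulr_ge0// ?invr_ge0 ?(ltW an0) ?(ltW bn0)//.
  by rewrite ler_wpM2r// invr_ge0 ltW.
case: n an0 bn0 {aV Hp i}  => [|m] an0 bn0; first by rewrite !(mul0r, mulr0).
rewrite /= exprMn.
have -> : b * (2 ^+ m.+1 * b ^- m.+1 * b ^- m.+1 * (d * (m.+1%:R * (2 ^+ m * b ^+ m)))) =
   m.+1%:R * (2 ^+ m.+1 * 2 ^+ m) * (d / b ^+ m.+1).
  rewrite !(exprSr b) invfM; field.
  by rewrite expf_neq0 ?gt_eqF.
have -> : 4 = 2 * 2 :> R by lra.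
rewrite ler_wpM2r ?divr_ge0 ?(ltW bn0)// ler_wpM2l// exprMn ler_wpM2l//.
by rewrite ler_eXn2l// ltr1n.
Qed.

End cauchy_kernel_bounds.

(** * Balls and dyadic shells *)

Section lebesgue_measure_of_balls.
Context {R : realType} {n : nat}.
Local Notation mu := (lebesgue_measure_n R n).

Lemma measurable_vnorm d (T : measurableType d) (F : T -> euclidean R n) :
  (forall i, measurable_fun setT (fun t => tnth (F t) i : R)) ->
  measurable_fun setT (fun t => vnorm (F t)).
Proof.
move=> mF; rewrite (_ : (fun t => vnorm (F t)) =
    (@powR R ^~ 2^-1) \o (fun t => \sum_(i < n) (tnth (F t) i : R) ^+ 2)).
  apply: measurableT_comp; first exact: measurable_powR.
  by apply: measurable_sum => i; exact: measurable_funX.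
apply/funext => t /=; rewrite powR12_sqrt//.
by apply: sumr_ge0 => i _; exact: sqr_ge0.
Qed.

Lemma measurable_tnthR (i : 'I_n) :
  measurable_fun setT (fun y : euclidean R n => tnth y i : R).
Proof. exact: measurable_tnth. Qed.

Lemma measurable_vsub d (T : measurableType d) (F G : T -> euclidean R n) i :
  (forall i, measurable_fun setT (fun t => tnth (F t) i : R)) ->
  (forall i, measurable_fun setT (fun t => tnth (G t) i : R)) ->
  measurable_fun setT (fun t => tnth (vsub (F t) (G t)) i : R).
Proof.
move=> mF mG; under eq_fun do rewrite tnth_vsub.
exact: measurable_funB.
Qed.

Lemma measurable_vball (c : euclidean R n) r : measurable (vball c r).
Proof.
have mf : measurable_fun setT (fun y => vnorm (vsub y c)).
  apply: measurable_vnorm => i; apply: measurable_vsub => // j.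
    exact: measurable_tnthR.
rewrite (_ : vball c r = setT `&` (fun y => vnorm (vsub y c)) @^-1` `]-oo, r[).
  by apply: mf.
by rewrite setTI; apply/seteqP; split => y /=; rewrite in_itv.
Qed.

Lemma lebesgue_measure_n_cube (c : euclidean R n) (r : R) : 0 <= r ->
  mu [set y | forall i, `]tnth c i - r, tnth c i + r[%classic (tnth y i)] =
  ((2 * r) ^+ n)%:E.
Proof.
move=> r0; rewrite (@lebesgue_measure_n_box R n
  (fun i => `]tnth c i - r, tnth c i + r[%classic)); last by move=> i; exact: measurable_itv.
rewrite (eq_bigr (fun=> (2 * r)%:E)); last first.
  move=> i _; rewrite lebesgue_measure_itv/= lte_fin.
  case: ltP => h; first by rewrite -EFinD; congr EFin; ring.
  by congr EFin; lra.
by rewrite prodEFin prodr_const card_ord.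
Qed.

Lemma measurable_cube (c : euclidean R n) (r : R) :
  measurable [set y : euclidean R n |
    forall i, `]tnth c i - r, tnth c i + r[%classic (tnth y i)].
Proof.
rewrite (_ : [set y | _] = \bigcap_(i in [set: 'I_n])
    ((fun y => tnth y i) @^-1` `]tnth c i - r, tnth c i + r[%classic)).
  apply: fin_bigcap_measurable => // i _; rewrite -[X in measurable X]setTI.
  by apply: measurable_tnth => //; exact: measurable_itv.
by apply/seteqP; split => y /= h i //=; exact: h.
Qed.

Lemma lebesgue_vball_le (c : euclidean R n) (r : R) : 0 <= r ->
  (mu (vball c r) <= ((2 * r) ^+ n)%:E)%E.
Proof.
move=> r0; rewrite -(lebesgue_measure_n_cube c r0).
apply: le_measure; rewrite ?inE; [exact: measurable_vball|exact: measurable_cube|].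
move=> y /= yr i; rewrite in_itv/=.
have := le_lt_trans (ler_tnth_vnorm (vsub y c) i) yr.
by rewrite tnth_vsub ltr_norml => /andP[? ?]; apply/andP; split; lra.
Qed.

(** An inscribed cube: its half-side [r / n] comes from bounding the Euclidean norm by the sum of
    the absolute coordinates. Only the order [r ^ n] matters for the final estimate. *)
Lemma lebesgue_vball_ge (c : euclidean R n) (r : R) : (0 < n)%N -> 0 < r ->
  (((2 * (r / n%:R)) ^+ n)%:E <= mu (vball c r))%E.
Proof.
move=> n0 r0; have nR : 0 < n%:R :> R by rewrite ltr0n.
rewrite -(lebesgue_measure_n_cube c (ltW (divr_gt0 r0 nR))).
apply: le_measure; rewrite ?inE; [exact: measurable_cube|exact: measurable_vball|].
move=> y /= yr; apply: le_lt_trans (vnorm_le_sum _) _.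
rewrite (_ : r = \sum_(i < n) (r / n%:R)); last first.
  by rewrite sumr_const card_ord -[RHS]mulr_natr divfK// gt_eqF.
apply: ltr_sum; first by apply/hasP; exists (Ordinal n0); rewrite ?mem_index_enum.
move=> i _; have := yr i; rewrite in_itv/= tnth_vsub ltr_norml => /andP[? ?].
by apply/andP; split; lra.
Qed.

Lemma lebesgue_vball_fin (c : euclidean R n) (r : R) : 0 <= r ->
  mu (vball c r) \is a fin_num.
Proof.
by move=> r0; rewrite ge0_fin_numE// (le_lt_trans (lebesgue_vball_le c r0)) ?ltry.
Qed.

End lebesgue_measure_of_balls.

Section dyadic.
Context {R : realType}.

Lemma ex_half_pow_lt (a e : R) : 0 < a -> 0 < e -> exists k : nat, a / 2 ^+ k < e.
Proof.
move=> a0 e0; have [k ak] : exists k : nat, a / e < k%:R.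
  by exists (Num.bound (a / e)); apply: archi_boundP; rewrite divr_ge0 ?ltW.
exists k; rewrite ltr_pdivrMr ?exprn_gt0//.
rewrite ltr_pdivrMr// in ak; apply: (lt_le_trans ak).
rewrite mulrC ler_pM2l// -natrX ler_nat ltnW//; exact: ltn_expl.
Qed.

(** Take the least exponent [j] with [rho / 2 ^ j <= t]; since [t < rho] it is not [0], and [k] is
    its predecessor. *)
Lemma dyadic_below (t rho : R) : 0 < t -> t < rho ->
  exists k : nat, rho / 2 ^+ k.+1 <= t /\ t < rho / 2 ^+ k.
Proof.
move=> t0 trho.
have ex : exists k : nat, rho / 2 ^+ k <= t.
  by have [k /ltW ?] := ex_half_pow_lt (lt_trans t0 trho) t0; exists k.
case: (ex_minnP ex) => -[|k] kt kmin; first by rewrite divr1 leNgt trho in kt.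
by exists k; split=> //; rewrite ltNge; apply/negP => /kmin; rewrite ltnn.
Qed.

Lemma dyadic_above (t rho : R) : 0 < rho -> rho <= t ->
  exists k : nat, rho * 2 ^+ k <= t /\ t < rho * 2 ^+ k.+1.
Proof.
move=> rho0 trho.
have ex : exists k : nat, t < rho * 2 ^+ k.
  have [k ?] := ex_half_pow_lt (lt_le_trans rho0 trho) rho0; exists k.
  by rewrite -ltr_pdivrMr// exprn_gt0.
case: (ex_minnP ex) => -[|k] kt kmin; first by rewrite mulr1 ltNge trho in kt.
by exists k; split=> //; rewrite leNgt; apply/negP => /kmin; rewrite ltnn.
Qed.

Lemma le_nneseries_term (u : (\bar R)^nat) k : (forall i, 0 <= u i)%E ->
  (u k <= \sum_(i <oo) u i)%E.
Proof.
move=> u0; apply: le_trans (nneseries_lim_ge k.+1 (fun i _ _ => u0 i)).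
rewrite (big_cat_nat (n := k))//= big_nat1.
by rewrite leeDr// sume_ge0.
Qed.

End dyadic.

(** The inverse agrees with the real power of exponent [-1] even where [f] vanishes, both being [0]
    there, so the singularity of the kernel needs no separate treatment. *)
Lemma measurable_fun_inv_ge0 {R : realType} d (T : measurableType d) (f : T -> R) :
  measurable_fun setT f -> (forall t, 0 <= f t) ->
  measurable_fun setT (fun t => (f t)^-1).
Proof.
move=> mf f0; rewrite (_ : (fun t => (f t)^-1) = (@powR R ^~ (-1)) \o f).
  by apply: measurableT_comp; first exact: measurable_powR.
by apply/funext => t /=; rewrite powR_inv1.
Qed.

(** * Integrals of |z|^(1-n) and of an L^n function over balls and their complements *)

Section riesz_kernel.
Context {R : realType} {n : nat}.
Hypothesis n_gt0 : (0 < n)%N.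
Local Notation mu := (lebesgue_measure_n R n).
Implicit Types (c x y z : euclidean R n) (r rho M : R).

Let expr_pred (a : R) : a ^+ n = a * a ^+ n.-1.
Proof. by rewrite -exprS prednK. Qed.

(* [|z|^(1 - n)], with value [0] at the origin as for [cauchy_kernel]. *)
Definition riesz_kernel z : R := vnorm z / vnorm z ^+ n.

Lemma riesz_kernel_ge0 z : 0 <= riesz_kernel z.
Proof. by rewrite divr_ge0 ?exprn_ge0 ?vnorm_ge0. Qed.

Lemma riesz_kernelC x y : riesz_kernel (vsub x y) = riesz_kernel (vsub y x).
Proof. by rewrite /riesz_kernel vdistC. Qed.

Lemma riesz_kernel_le z (s : R) : 0 < s -> s <= vnorm z ->
  riesz_kernel z <= (s^-1) ^+ n.-1.
Proof.
move=> s0 sz; have z0 := lt_le_trans s0 sz; rewrite /riesz_kernel.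
rewrite expr_pred invfM mulrA divff ?gt_eqF// mul1r -exprVn.
rewrite lerXn2r ?nnegrE ?invr_ge0 ?vnorm_ge0 ?(ltW s0)//.
by rewrite lef_pV2 ?posrE.
Qed.

Lemma measurable_riesz_kernel d (T : measurableType d) (F : T -> euclidean R n) :
  (forall i, measurable_fun setT (fun t => tnth (F t) i : R)) ->
  measurable_fun setT (fun t => riesz_kernel (F t)).
Proof.
move=> mF; have mv := measurable_vnorm mF.
apply: measurable_funM => //.
apply: measurable_fun_inv_ge0; first exact: measurable_funX.
by move=> t; rewrite exprn_ge0// vnorm_ge0.
Qed.

Lemma integral_riesz_kernel_vball y rho : 0 < rho ->
  (\int[mu]_(x in vball y rho) (riesz_kernel (vsub x y))%:E
   <= (4 ^+ n * rho)%:E)%E.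
Proof.
move=> rho0; have mB r := @measurable_vball R n y r.
(* [c k] bounds the kernel on the shell [rho / 2 ^ (k + 1) <= |x - y| < rho / 2 ^ k]. In [f k] the
   whole ball replaces the shell, which only enlarges the dominating series. *)
pose c k := (2 ^+ k.+1 / rho) ^+ n.-1.
have c0 k : 0 <= c k by rewrite exprn_ge0// divr_ge0// ?exprn_ge0// ltW.
pose f k x := ((c k)%:E * (\1_(vball y (rho / 2 ^+ k)) x)%:E)%E.
have f0 k x : (0 <= f k x)%E by rewrite mule_ge0// lee_fin.
have mf k : measurable_fun (vball y rho) (f k).
  apply: measurable_funeM; apply/measurable_EFinP; exact: measurable_indic.
apply: (@le_trans _ _ (\int[mu]_(x in vball y rho) (\sum_(k <oo) f k x)))%E.
  apply: ge0_le_integral => //.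
  - by move=> x _; rewrite lee_fin riesz_kernel_ge0.
  - apply/measurable_EFinP; apply: measurable_funTS.
    by apply: measurable_riesz_kernel => i; apply: measurable_vsub => // j;
      exact: measurable_tnthR.
  - exact: ge0_emeasurable_sum.
  move=> x /= xrho.
  have [z0|z0] := leP (vnorm (vsub x y)) 0.
    rewrite /riesz_kernel (_ : vnorm _ = 0) ?mul0r ?nneseries_ge0//.
    by apply/eqP; rewrite eq_le z0 vnorm_ge0.
  have [k [k1 k2]] := dyadic_below z0 xrho.
  apply: le_trans (le_nneseries_term k (fun i => f0 i x)).
  rewrite /f indicE mem_set//= mule1 lee_fin.
  apply: le_trans (riesz_kernel_le _ k1) _; last by rewrite invf_div.
  by rewrite divr_gt0// exprn_gt0.
rewrite integral_nneseries//.
(* Term [k] is at most [c k * (2 * rho / 2 ^ k) ^ n = 4 ^ n * rho / 2 ^ (k + 1)], a geometric series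
   of sum [4 ^ n * rho]. *)
apply: le_trans (epsilon_trick0 xpredT _); last first.
  by rewrite mulr_ge0 ?exprn_ge0// ltW.
apply: lee_nneseries => [k _ _|k _]; first exact: integral_ge0.
rewrite ge0_integralZl_EFin//; last by apply/measurable_EFinP; exact: measurable_indic.
rewrite integral_indic//.
apply: (@le_trans _ _ ((c k)%:E * ((2 * (rho / 2 ^+ k)) ^+ n)%:E)%E).
  rewrite lee_wpmul2l ?lee_fin//.
  apply: (@le_trans _ _ (mu (vball y (rho / 2 ^+ k)))).
    by apply: le_measure; rewrite ?inE; [apply: measurableI|exact: mB|exact: subIsetl].
  by apply: lebesgue_vball_le; rewrite divr_ge0// ?exprn_ge0// ltW.
rewrite -EFinM lee_fin /c natrX !expr_pred !exprS.
rewrite (_ : 4 = 2 * 2) ?exprMn ?exprVn; last by lra.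
have p2 m : 2 ^+ m != 0 :> R by rewrite expf_neq0.
rewrite le_eqVlt; apply/orP; left; apply/eqP.
rewrite -![(2 ^+ k) ^+ _]exprM.
field.
by rewrite !expf_neq0// gt_eqF.
Qed.

Section local_lebesgue.
Variables (u : euclidean R n -> R) (M : R).
Hypothesis M_gt0 : 0 < M.
Hypothesis u_ge0 : forall y, 0 <= u y.
Hypothesis mu_u : measurable_fun setT u.
Hypothesis int_u : (\int[mu]_y (u y ^+ n)%:E <= (M ^+ n)%:E)%E.

Let mu_uE D : measurable_fun D (fun y => (u y)%:E).
Proof. by apply/measurable_EFinP; exact: measurable_funTS. Qed.

Lemma integral_vball_le c rho : 0 < rho ->
  (\int[mu]_(y in vball c rho) (u y)%:E
   <= ((2 ^+ n + 1) * rho ^+ n.-1 * M)%:E)%E.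
Proof.
move=> rho0; have mB r := @measurable_vball R n c r.
(* [u <= l + u^n / l^(n-1)] for every [l > 0]; this [l] balances the two terms. *)
pose l := M / rho; have l0 : 0 < l by rewrite divr_gt0.
have lX0 m : 0 < l ^+ m by rewrite exprn_gt0.
have mun : measurable_fun setT (fun y => (u y ^+ n)%:E).
  by apply/measurable_EFinP; exact: measurable_funX.
apply: (@le_trans _ _ (\int[mu]_(y in vball c rho)
    (l%:E + (l ^- n.-1)%:E * (u y ^+ n)%:E)))%E.
  apply: ge0_le_integral => //.
  - by move=> y _; rewrite lee_fin.
  - by apply: emeasurable_funD => //; apply: measurable_funeM; exact: measurable_funTS.
  move=> y _; rewrite -EFinM -EFinD lee_fin.
  have [ul|lu] := leP (u y) l.
    by rewrite (le_trans ul)// lerDl mulr_ge0 ?invr_ge0 ?exprn_ge0// ltW.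
  apply: (@le_trans _ _ (l ^- n.-1 * u y ^+ n)); last by rewrite lerDr ltW.
  rewrite expr_pred mulrCA ler_peMr// mulrC ler_pdivlMr// mul1r.
  by rewrite lerXn2r ?nnegrE// ltW.
rewrite ge0_integralD//; last 3 first.
- by move=> y _; rewrite lee_fin ltW.
- by move=> y _; rewrite -EFinM lee_fin mulr_ge0 ?invr_ge0 ?exprn_ge0// ltW.
- by apply: measurable_funeM; exact: measurable_funTS.
rewrite integral_cst// ge0_integralZl_EFin//; last 3 first.
- by move=> y _; rewrite lee_fin exprn_ge0.
- exact: measurable_funTS.
- by rewrite invr_ge0 ltW.
(* With [l = M / rho] these two terms are [2 ^ n] and [1] times [rho ^ (n - 1) * M]: Hölder's bound
   on a ball, up to the constant. *)
apply: (@le_trans _ _ (l%:E * ((2 * rho) ^+ n)%:E + (l ^- n.-1)%:E * (M ^+ n)%:E))%E.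
  have l1 : (0 <= (l ^- n.-1)%:E)%E by rewrite lee_fin invr_ge0 ltW.
  have l2 : (0 <= l%:E)%E by rewrite lee_fin ltW.
  apply: leeD; first by apply/(lee_wpmul2l l2)/lebesgue_vball_le/ltW.
  apply: (lee_wpmul2l l1).
  apply: le_trans int_u; apply: ge0_subset_integral => //.
  by move=> y _; rewrite lee_fin exprn_ge0.
rewrite -!EFinM -EFinD lee_fin /l !expr_pred !exprMn !exprVn.
rewrite le_eqVlt; apply/orP; left; apply/eqP.
field.
by rewrite !expf_neq0 ?gt_eqF.
Qed.

Lemma integral_tail_le c rho : 0 < rho ->
  (\int[mu]_(y in ~` vball c rho) (u y / vnorm (vsub y c) ^+ n)%:E
   <= ((2 ^+ n + 1) * 2 ^+ n * M / rho)%:E)%E.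
Proof.
move=> rho0; have mB r := @measurable_vball R n c r.
(* [a k] bounds [|y - c| ^- n] on the shell from [rho * 2 ^ k] to [rho * 2 ^ (k + 1)]. The integral
   of [u] over the outer ball grows only like the power [n - 1] of its radius, so term [k] is of
   order [2 ^ (- k) * M / rho] and the series converges. *)
pose a k := (rho * 2 ^+ k) ^- n.
have a0 k : 0 <= a k by rewrite invr_ge0 exprn_ge0// mulr_ge0 ?exprn_ge0// ltW.
pose f k y := ((a k)%:E * (\1_(vball c (rho * 2 ^+ k.+1)) y * u y)%:E)%E.
have f0 k x : (0 <= f k x)%E by rewrite mule_ge0// lee_fin// mulr_ge0.
have mfT k : measurable_fun setT (fun y => (\1_(vball c (rho * 2 ^+ k.+1)) y * u y)%:E).
  by apply/measurable_EFinP; apply: measurable_funM => //; exact: measurable_indic.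
have mf k : measurable_fun (~` vball c rho) (f k).
  by apply: measurable_funeM; exact: measurable_funTS.
have mV : measurable_fun setT (fun y => vnorm (vsub y c)).
  by apply: measurable_vnorm => i; apply: measurable_vsub => // j; exact: measurable_tnthR.
have mC : measurable (~` vball c rho) by apply: measurableC; exact: mB.
apply: (@le_trans _ _ (\int[mu]_(x in ~` vball c rho) (\sum_(k <oo) f k x)))%E.
  apply: ge0_le_integral => //.
  - by move=> x _; rewrite lee_fin mulr_ge0// invr_ge0 exprn_ge0// vnorm_ge0.
  - apply/measurable_EFinP; apply: measurable_funTS; apply: measurable_funM => //.
    apply: measurable_fun_inv_ge0; first exact: measurable_funX.
    by move=> y; rewrite exprn_ge0// vnorm_ge0.
  - exact: ge0_emeasurable_sum.
  move=> x /= /negP; rewrite -leNgt => xrho.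
  have [k [k1 k2]] := dyadic_above rho0 xrho.
  apply: le_trans (le_nneseries_term k (fun i => f0 i x)).
  rewrite /f indicE mem_set//= mul1r -EFinM lee_fin mulrC ler_wpM2r//.
  have p0 : 0 < rho * 2 ^+ k by rewrite mulr_gt0// exprn_gt0.
  rewrite lef_pV2 ?posrE ?exprn_gt0//; last exact: lt_le_trans k1.
  by rewrite lerXn2r ?nnegrE ?vnorm_ge0// ltW.
rewrite integral_nneseries//.
apply: le_trans (epsilon_trick0 xpredT _); last first.
  by rewrite divr_ge0 ?mulr_ge0 ?addr_ge0 ?exprn_ge0// ltW.
apply: lee_nneseries => [k _ _|k _]; first exact: integral_ge0.
rewrite ge0_integralZl_EFin//; last 2 first.
- by move=> x _; rewrite lee_fin mulr_ge0.
- exact: measurable_funTS.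
have rk0 : 0 < rho * 2 ^+ k.+1 by rewrite mulr_gt0// exprn_gt0.
apply: (@le_trans _ _ ((a k)%:E *
    ((2 ^+ n + 1) * (rho * 2 ^+ k.+1) ^+ n.-1 * M)%:E)%E).
  rewrite lee_wpmul2l ?lee_fin//.
  apply: le_trans (integral_vball_le c rk0).
  rewrite [leRHS]integral_mkcond.
  apply: (@le_trans _ _ (\int[mu]_y (\1_(vball c (rho * 2 ^+ k.+1)) y * u y)%:E)%E).
    by apply: ge0_subset_integral => // y _; rewrite lee_fin mulr_ge0.
  rewrite le_eqVlt; apply/orP; left; apply/eqP; apply: eq_integral => y _.
  by rewrite patchE indicE; case: ifPn => _; rewrite ?mul1r ?mul0r.
rewrite -EFinM lee_fin /a natrX !expr_pred !exprS.
have p2 m : 2 ^+ m != 0 :> R by rewrite expf_neq0.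
rewrite le_eqVlt; apply/orP; left; apply/eqP.
rewrite !exprMn -![(2 ^+ k) ^+ _]exprM.
field.
by rewrite !expf_neq0// gt_eqF.
Qed.

End local_lebesgue.

End riesz_kernel.

(** * The majorant of the renormalized kernel on a ball *)

Section majorant.
Context {R : realType} {n : nat}.
Hypothesis n_gt0 : (0 < n)%N.
Local Notation mu := (lebesgue_measure_n R n).
Variables (u : euclidean R n -> R) (M : R).
Hypothesis M_gt0 : 0 < M.
Hypothesis u_ge0 : forall y, 0 <= u y.
Hypothesis mu_u : measurable_fun setT u.
Hypothesis int_u : (\int[mu]_y (u y ^+ n)%:E <= (M ^+ n)%:E)%E.
Variables (c : euclidean R n) (r : R).
Hypothesis r_gt0 : 0 < r.

Let near_part x y : R := \1_(vball c (2 * r)) y * riesz_kernel (vsub y x) * u y.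

(** The coefficient is that of [cauchy_kernel_dist_le] for the vectors [y - x] and [y - c]. The
    radius [2 * r] is what makes that lemma applicable: it gives [|x - c| < r <= |y - c| / 2]. *)
Let far_part y : R :=
  \1_(~` vball c (2 * r)) y * (n.+1%:R * 4 ^+ n * r * (u y / vnorm (vsub y c) ^+ n)).

(* Dominates the kernel [K(y - x)] for [y] near [c], and [K(y - x) - K(y - c)]
   for [y] far from [c], uniformly for [x] in the ball of radius [r]. *)
Definition majorant x y : R := near_part x y + far_part y.

Let near_part_ge0 x y : 0 <= near_part x y.
Proof. by rewrite mulr_ge0// mulr_ge0// riesz_kernel_ge0. Qed.

Let far_part_ge0 y : 0 <= far_part y.
Proof.
rewrite mulr_ge0// mulr_ge0//; first by rewrite !mulr_ge0// ltW.
by rewrite divr_ge0// exprn_ge0// vnorm_ge0.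
Qed.

Lemma majorant_ge0 x y : 0 <= majorant x y.
Proof. by rewrite addr_ge0. Qed.

Let mB (s : R) : measurable (vball c s). Proof. exact: measurable_vball. Qed.

Let m1B (s : R) : measurable_fun setT (\1_(vball c s) : euclidean R n -> R).
Proof. exact: measurable_indic. Qed.

Let measurable_near_part :
  measurable_fun setT (fun p : euclidean R n * euclidean R n => near_part p.1 p.2).
Proof.
apply: measurable_funM.
  apply: measurable_funM.
    exact: (measurableT_comp (m1B _) measurable_snd).
  apply: measurable_riesz_kernel => i.
  by apply: measurable_vsub => j; apply: (measurableT_comp (measurable_tnthR j)).
exact: measurableT_comp.
Qed.

Let measurable_far_part : measurable_fun setT far_part.
Proof.
apply: measurable_funM.
  by apply: measurable_indic; apply: measurableC; exact: mB.
apply: measurable_funM => //; apply: measurable_funM => //.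
apply: measurable_fun_inv_ge0.
  apply: measurable_funX; apply: measurable_vnorm => i.
  by apply: measurable_vsub => // j; exact: measurable_tnthR.
by move=> y; rewrite exprn_ge0// vnorm_ge0.
Qed.

Lemma measurable_majorant : measurable_fun setT
  (fun p : euclidean R n * euclidean R n => (majorant p.1 p.2)%:E).
Proof.
apply/measurable_EFinP; apply: measurable_funD => //.
exact: (measurableT_comp measurable_far_part).
Qed.

Let integral_near_part :
  (\int[mu]_(x in vball c r) \int[mu]_y (near_part x y)%:E
   <= (4 ^+ n * (3 * r) * ((2 ^+ n + 1) * (2 * r) ^+ n.-1 * M))%:E)%E.
Proof.
pose f (p : euclidean R n * euclidean R n) : \bar R :=
  ((\1_(vball c r) p.1)%:E * (near_part p.1 p.2)%:E)%E.
have f0 p : (0 <= f p)%E by rewrite mule_ge0 ?lee_fin.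
have mf : measurable_fun setT f.
  apply: emeasurable_funM; apply/measurable_EFinP => //.
  exact: (measurableT_comp (m1B _) measurable_fst).
have mnear x : measurable_fun setT (fun y => (near_part x y)%:E).
  apply/measurable_EFinP.
  exact: (measurableT_comp measurable_near_part (measurable_pair1 x)).
rewrite (_ : (\int[mu]_(x in _) _)%E = (\int[mu]_x \int[mu]_y f (x, y))%E); last first.
  rewrite integral_mkcond; apply: eq_integral => x _.
  rewrite /f/= ge0_integralZl_EFin//; last by move=> y _; rewrite lee_fin.
  by rewrite patchE indicE; case: ifPn => _; rewrite ?mul1e ?mul0e.
(* Integrating in [x] first replaces the singular kernel by the factor [4 ^ n * (3 * r)] and leaves
   the integral of [u] over [B(c, 2r)]. *)
rewrite (fubini_tonelli f)//.
have r2 : 0 < 2 * r by rewrite mulr_gt0.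
have k0 : 0 <= 4 ^+ n * (3 * r) by rewrite mulr_ge0 ?exprn_ge0// mulr_ge0// ltW.
apply: (@le_trans _ _ (\int[mu]_(y in vball c (2 * r))
   ((4 ^+ n * (3 * r))%:E * (u y)%:E)))%E; last first.
  rewrite ge0_integralZl_EFin//; last 2 first.
  - by move=> y _; rewrite lee_fin.
  - by apply/measurable_EFinP; exact: measurable_funTS.
  rewrite [leRHS]EFinM lee_wpmul2l ?lee_fin//.
  exact: integral_vball_le.
rewrite [leRHS]integral_mkcond; apply: ge0_le_integral => //.
- by move=> y _; exact: integral_ge0.
- exact: (measurable_fun_fubini_tonelli_G (m1 := mu) f).
- apply/(measurable_restrictT _ _).1 => //; apply: measurable_funeM.
  by apply/measurable_EFinP; exact: measurable_funTS.
move=> y _; rewrite patchE; case: ifPn => [|/negbTE] yB; last first.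
  rewrite integral0_eq// => x _.
  by rewrite /f /near_part indicE [in X in (_ * X)%E]indicE yB !mul0r mule0.
have mK : measurable_fun setT (fun x => (riesz_kernel (vsub y x))%:E).
  apply/measurable_EFinP; apply: measurable_riesz_kernel => i.
  by apply: measurable_vsub => // j; exact: measurable_tnthR.
rewrite (_ : (\int[mu]_x _)%E =
    ((u y)%:E * \int[mu]_(x in vball c r) (riesz_kernel (vsub y x))%:E)%E); last first.
  rewrite -ge0_integralZl_EFin//; last 2 first.
  - by move=> x _; rewrite lee_fin riesz_kernel_ge0.
  - exact: measurable_funTS.
  rewrite [RHS]integral_mkcond; apply: eq_integral => x _; rewrite /f /= patchE /near_part !indicE yB mul1r.
  case: ifPn => _; last by rewrite mul0e.
  by rewrite mul1e -EFinM mulrC.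
rewrite muleC; apply: lee_wpmul2r; first by rewrite lee_fin.
(* For [y] in [B(c, 2r)] the ball [B(c, r)] lies in [B(y, 3r)], which is centred at the
   singularity. *)
apply: le_trans (integral_riesz_kernel_vball n_gt0 y _); last by rewrite mulr_gt0.
under eq_integral do rewrite riesz_kernelC.
apply: ge0_subset_integral => //.
- exact: measurable_vball.
- apply: measurable_funTS; under eq_fun do rewrite riesz_kernelC.
  exact: mK.
- by move=> x _; rewrite lee_fin riesz_kernel_ge0.
move=> x; move: yB; rewrite inE /vball/= => yB xr.
have := vdist_triangle c x y; rewrite (vdistC c y); lra.
Qed.

Let integral_far_part :
  (\int[mu]_y (far_part y)%:E <=
   (n.+1%:R * 4 ^+ n * r * ((2 ^+ n + 1) * 2 ^+ n * M / (2 * r)))%:E)%E.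
Proof.
have r2 : 0 < 2 * r by rewrite mulr_gt0.
have k0 : 0 <= n.+1%:R * 4 ^+ n * r by rewrite !mulr_ge0// ltW.
rewrite [leRHS]EFinM; apply: le_trans (lee_wpmul2l _
  (integral_tail_le n_gt0 M_gt0 u_ge0 mu_u int_u c r2)); rewrite ?lee_fin//.
have mC : measurable (~` vball c (2 * r)) by apply: measurableC; exact: mB.
rewrite -ge0_integralZl_EFin//; last 2 first.
- by move=> y _; rewrite lee_fin divr_ge0// exprn_ge0// vnorm_ge0.
- apply/measurable_EFinP; apply: measurable_funTS; apply: measurable_funM => //.
  apply: measurable_fun_inv_ge0.
    apply: measurable_funX; apply: measurable_vnorm => i.
    by apply: measurable_vsub => // j; exact: measurable_tnthR.
  by move=> y; rewrite exprn_ge0// vnorm_ge0.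
rewrite [leRHS]integral_mkcond le_eqVlt; apply/orP; left; apply/eqP.
apply: eq_integral => y _; rewrite /far_part patchE indicE.
by case: ifPn => _; rewrite ?mul1r ?mul0r// EFinM.
Qed.

(** The first summand is the near part. The second is the far part, which does not depend on [x] and
    is therefore multiplied by [|B(c, r)| <= (2 * r) ^ n]; its division by [2] comes from the tail
    radius [2 * r]. *)
Definition majorant_const : R :=
  4 ^+ n * 3 * ((2 ^+ n + 1) * 2 ^+ n.-1) +
  n.+1%:R * 4 ^+ n * ((2 ^+ n + 1) * 2 ^+ n / 2) * 2 ^+ n.

Lemma integral_majorant_le :
  (\int[mu]_(x in vball c r) \int[mu]_y (majorant x y)%:E
   <= (majorant_const * r ^+ n * M)%:E)%E.
Proof.
have mnear x : measurable_fun setT (fun y => (near_part x y)%:E).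
  apply/measurable_EFinP.
  exact: (measurableT_comp measurable_near_part (measurable_pair1 x)).
have mfar : measurable_fun setT (fun y => (far_part y)%:E).
  exact/measurable_EFinP.
have mJ : measurable_fun setT (fun x => \int[mu]_y (near_part x y)%:E)%E.
  apply: (measurable_fun_fubini_tonelli_F (m2 := mu)
    (fun p => (near_part p.1 p.2)%:E)) => [|p]; last by rewrite lee_fin.
  exact/measurable_EFinP.
have -> : (\int[mu]_(x in vball c r) \int[mu]_y (majorant x y)%:E =
  \int[mu]_(x in vball c r) (\int[mu]_y (near_part x y)%:E + \int[mu]_y (far_part y)%:E))%E.
  apply: eq_integral => x _; rewrite -ge0_integralD//.
  - by move=> y _; rewrite lee_fin.
  - by move=> y _; rewrite lee_fin.
rewrite ge0_integralD//; last 3 first.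
- by move=> x _; apply: integral_ge0 => y _; rewrite lee_fin.
- exact: measurable_funTS.
- by move=> x _; apply: integral_ge0 => y _; rewrite lee_fin.
rewrite integral_cst//.
apply: le_trans (leeD integral_near_part (lee_pmul _ _ integral_far_part
  (lebesgue_vball_le c (ltW r_gt0)))) _; rewrite ?measure_ge0//.
  by apply: integral_ge0 => y _; rewrite lee_fin.
rewrite -EFinM -EFinD lee_fin le_eqVlt; apply/orP; left; apply/eqP.
have E (a : R) : a ^+ n = a * a ^+ n.-1 by rewrite -exprS prednK.
rewrite /majorant_const !exprMn (E r); field.
by rewrite gt_eqF.
Qed.

End majorant.

(** * Mean oscillation of the transform *)

Section coordinate_form.
Context {R : realType} {n : nat}.
Implicit Types (a : 'I_n -> {set 'I_n} -> R) (v : euclidean R n)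
  (w : multivector R n).

(** One fixed coordinate of either exterior algebra product has this shape; the choice of product
    and of coordinate is recorded in [a] alone. *)
Definition coord_form a v w : R := \sum_i \sum_T a i T * (tnth v i * w T).

Definition coord_form_bound a : R := \sum_i \sum_T `|a i T|.

Lemma coord_form_bound_ge0 a : 0 <= coord_form_bound a.
Proof. by apply: sumr_ge0 => i _; exact: sumr_ge0. Qed.

Lemma ler_mv_norm w T : `|w T| <= mv_norm w.
Proof.
rewrite /mv_norm /mv_inner; under eq_bigr do rewrite -expr2.
exact: (ler_sqrt_sum_sqr (fun T => w T)).
Qed.

Lemma mv_norm_le_sum w : mv_norm w <= \sum_T `|w T|.
Proof.
rewrite /mv_norm /mv_inner; under eq_bigr do rewrite -expr2.
exact: (sqrt_sum_sqr_le (fun T => w T)).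
Qed.

Lemma mv_norm_ge0 w : 0 <= mv_norm w. Proof. exact: sqrtr_ge0. Qed.

Lemma coord_form_le a v w (m : R) : (forall i, `|tnth v i : R| <= m) ->
  `|coord_form a v w| <= coord_form_bound a * (m * mv_norm w).
Proof.
move=> vm; rewrite mulr_suml; apply: le_trans (ler_norm_sum _ _ _) _.
apply: ler_sum => i _; rewrite mulr_suml; apply: le_trans (ler_norm_sum _ _ _) _.
apply: ler_sum => T _; rewrite normrM ler_wpM2l// normrM.
by apply: ler_pM => //; exact: ler_mv_norm.
Qed.

Lemma coord_formB a v1 v2 w :
  coord_form a (vsub v1 v2) w = coord_form a v1 w - coord_form a v2 w.
Proof.
rewrite /coord_form -sumrB; apply: eq_bigr => i _; rewrite -sumrB.
by apply: eq_bigr => T _; rewrite tnth_vsub; ring.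
Qed.

Lemma measurable_coord_form a d (X : measurableType d)
    (F : X -> euclidean R n) (g : X -> multivector R n) :
  (forall i, measurable_fun setT (fun t => tnth (F t) i : R)) ->
  (forall T, measurable_fun setT (fun t => g t T)) ->
  measurable_fun setT (fun t => coord_form a (F t) (g t)).
Proof.
move=> mF mg; apply: measurable_sum => i; apply: measurable_sum => T.
by apply: measurable_funM => //; exact: measurable_funM.
Qed.

Lemma measurable_mv_norm d (X : measurableType d) (g : X -> multivector R n) :
  (forall T, measurable_fun setT (fun t => g t T)) ->
  measurable_fun setT (fun t => mv_norm (g t)).
Proof.
move=> mg; rewrite (_ : (fun t => mv_norm (g t)) =
    (@powR R ^~ 2^-1) \o (fun t => \sum_T g t T * g t T)).
  apply: measurableT_comp; first exact: measurable_powR.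
  by apply: measurable_sum => T; exact: measurable_funM.
apply/funext => t /=; rewrite powR12_sqrt//.
by apply: sumr_ge0 => T _; rewrite -expr2 sqr_ge0.
Qed.

Lemma measurable_cauchy_kernel d (X : measurableType d)
    (F : X -> euclidean R n) i :
  (forall i, measurable_fun setT (fun t => tnth (F t) i : R)) ->
  measurable_fun setT (fun t => tnth (cauchy_kernel (F t)) i : R).
Proof.
move=> mF; under eq_fun do rewrite tnth_vscale.
apply: measurable_funM => //; apply: measurable_fun_inv_ge0.
  by apply: measurable_funX; exact: measurable_vnorm.
by move=> t; rewrite exprn_ge0// vnorm_ge0.
Qed.

End coordinate_form.

Section mean_oscillation.
Local Open Scope ereal_scope.
Context d (T : measurableType d) (R : realType) (mu : {measure set T -> \bar R}).
Variables (B : set T) (f : T -> R) (a Q : R).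
Hypothesis mB : measurable B.
Hypothesis muB : mu B \is a fin_num.
Hypothesis mf : measurable_fun setT f.
Hypothesis faQ : \int[mu]_(x in B) `|f x - a|%:E <= Q%:E.

Let integrable_cst_B (b : R) : mu.-integrable B (EFin \o cst b).
Proof.
apply/integrableP; split; first exact/measurable_EFinP/measurable_cst.
rewrite (eq_integral (cst `|b%:E|))// integral_cst//=.
by rewrite lte_mul_pinfty ?lee_fin// -ge0_fin_numE.
Qed.

Let measurable_dist : measurable_fun B (EFin \o (fun x => f x - a)%R).
Proof.
by apply/measurable_EFinP; apply: measurable_funTS; exact: measurable_funB.
Qed.

Let integrable_dist : mu.-integrable B (EFin \o (fun x => f x - a)%R).
Proof. by apply/integrableP; split=> //; rewrite (le_lt_trans faQ) ?ltry. Qed.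

Lemma integrable_of_dist : mu.-integrable B (EFin \o f).
Proof.
rewrite (_ : EFin \o f = fun x => (EFin \o (fun x => f x - a)%R) x + (EFin \o cst a) x).
  exact: integrableD.
by apply/funext => x /=; rewrite -EFinD subrK.
Qed.

(** Any constant [a] may replace the mean [m] at the price of a factor [2]: [m - a] is the mean of
    [f - a], so [|m - a|] integrated over [B] is again at most [Q]. *)
Lemma mean_oscillation_le : (0 < fine (mu B))%R ->
  \int[mu]_(x in B) `|f x - (fine (mu B))^-1 * (\int[mu]_(x in B) f x)%R|%:E
  <= (2 * Q)%:E.
Proof.
move=> B0; set m := (_ * _)%R.
have E : (m - a = (fine (mu B))^-1 * \int[mu]_(x in B) (f x - a))%R.
  rewrite (RintegralB mB integrable_of_dist (integrable_cst_B a)).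
  by rewrite Rintegral_cst// mulrBr mulrCA mulVf ?mulr1// gt_eqF.
have ma : (`|m - a| * fine (mu B))%:E <= Q%:E.
  rewrite E normrM gtr0_norm ?invr_gt0// mulrAC mulVf ?gt_eqF// mul1r.
  rewrite EFin_normr_Rintegral//.
  exact: (le_trans (le_abse_integral _ mB measurable_dist) faQ).
apply: (@le_trans _ _ (\int[mu]_(x in B) (`|f x - a|%:E + `|m - a|%:E))).
  apply: ge0_le_integral => //.
  - apply/measurable_EFinP; apply: measurableT_comp => //.
    by apply: measurable_funTS; exact: measurable_funB.
  - apply: emeasurable_funD => //; apply/measurable_EFinP.
    apply: measurableT_comp => //; exact/measurable_EFinP.
  move=> x _; rewrite -EFinD lee_fin.
  by rewrite (_ : f x - m = (f x - a) - (m - a))%R ?ler_normB//; ring.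
rewrite ge0_integralD//; last first.
  apply/measurable_EFinP; apply: measurableT_comp => //; exact/measurable_EFinP.
rewrite integral_cst// -(fineK muB) -EFinM.
by apply: (le_trans (leeD faQ ma)); rewrite -EFinD lee_fin mulr_natl mulr2n.
Qed.

End mean_oscillation.

(** * Convergence and oscillation of the renormalized transforms *)

Section renormalized_transform.
Context {R : realType} {n : nat}.
Hypothesis n_gt0 : (0 < n)%N.
Local Notation mu := (lebesgue_measure_n R n).
Variables (a : 'I_n -> {set 'I_n} -> R) (phi : euclidean R n -> multivector R n).
Variable M : R.
Hypothesis M_gt0 : 0 < M.
Hypothesis mphi : forall T, measurable_fun setT (fun y => phi y T).
Hypothesis int_phi : (\int[mu]_y (mv_norm (phi y) ^+ n)%:E <= (M ^+ n)%:E)%E.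

Let u y := mv_norm (phi y).
Let u_ge0 y : 0 <= u y. Proof. exact: mv_norm_ge0. Qed.
Let mu_u : measurable_fun setT u. Proof. exact: measurable_mv_norm. Qed.

(* Changing [c] and [rho] alters this by a term independent of [x]; the Cauchy
   transforms of the statement have [c = 0] and [rho = 1]. *)
Definition renormalized_kernel (c : euclidean R n) (rho : R) (x y : euclidean R n) :
    euclidean R n :=
  vsub (cauchy_kernel (vsub y x))
       (vscale (\1_(~` vball c rho) y) (cauchy_kernel (vsub y c))).

Definition transform_integrand c rho x y : R :=
  coord_form a (renormalized_kernel c rho x y) (phi y).

Definition renormalized_transform c rho x : R :=
  \int[mu]_y transform_integrand c rho x y.

Lemma measurable_transform_integrand c rho : measurable_fun setT
  (fun p : euclidean R n * euclidean R n => transform_integrand c rho p.1 p.2).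
Proof.
have m2 i : measurable_fun setT
    (fun p : euclidean R n * euclidean R n => tnth p.2 i : R).
  exact: (measurableT_comp (measurable_tnthR i) measurable_snd).
have m1 i : measurable_fun setT
    (fun p : euclidean R n * euclidean R n => tnth p.1 i : R).
  exact: (measurableT_comp (measurable_tnthR i) measurable_fst).
apply: measurable_coord_form => [i|T]; last first.
  exact: (measurableT_comp (mphi T) measurable_snd).
apply: measurable_vsub => {}i.
  by apply: measurable_cauchy_kernel => {}i; exact: measurable_vsub.
under eq_fun do rewrite tnth_vscale; apply: measurable_funM.
  have mI : measurable_fun setT (\1_(~` vball c rho) : euclidean R n -> R).
    by apply: measurable_indic; apply: measurableC; exact: measurable_vball.
  exact: (measurableT_comp mI measurable_snd).
by apply: measurable_cauchy_kernel => {}i; exact: measurable_vsub.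
Qed.

Lemma measurable_transform_integrand_r c rho x :
  measurable_fun setT (fun y => transform_integrand c rho x y).
Proof.
exact: (measurableT_comp (measurable_transform_integrand c rho) (measurable_pair1 x)).
Qed.

Lemma transform_integrand_le c r x y : 0 < r -> vball c r x ->
  `|transform_integrand c (2 * r) x y| <= coord_form_bound a * majorant u c r x y.
Proof.
move=> r0; rewrite /vball/= => xr.
pose m : R := \1_(vball c (2 * r)) y * riesz_kernel (vsub y x) +
  \1_(~` vball c (2 * r)) y * (n.+1%:R * 4 ^+ n * r / vnorm (vsub y c) ^+ n).
have -> : majorant u c r x y = m * u y.
  rewrite /majorant /m [RHS]mulrDl; congr (_ + _).
  rewrite -[RHS]mulrA; congr (_ * _); rewrite -[RHS]mulrA; congr (_ * _).
  exact: mulrC.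
apply: coord_form_le => i; rewrite tnth_vsub tnth_vscale /m !indicE in_setC.
have [yB|yB] := boolP (y \in vball c (2 * r)); rewrite ?mul1r ?mul0r ?subr0 ?addr0 ?add0r.
  exact: cauchy_kernel_le.
have yr : 2 * r <= vnorm (vsub y c) by rewrite leNgt; apply: contra yB => ?; rewrite inE.
have E : vnorm (vsub (vsub y x) (vsub y c)) = vnorm (vsub x c).
  by rewrite vsub_sub2l vdistC.
apply: le_trans (cauchy_kernel_dist_le i _ _) _; rewrite ?E; [lra|lra|].
rewrite -!mulrA ler_wpM2l// ler_wpM2l ?exprn_ge0// ler_wpM2r ?ltW//.
by rewrite invr_gt0 exprn_gt0//; lra.
Qed.

(** The terms [K(y - x)] cancel, so the difference of two normalizations is the same for every
    [x]. *)
Lemma transform_integrandB c rho c' rho' x x' y :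
  transform_integrand c rho x y - transform_integrand c' rho' x y =
  transform_integrand c rho x' y - transform_integrand c' rho' x' y.
Proof. by rewrite /transform_integrand -!coord_formB !vsub_sub2l. Qed.

Let majorant_int c r x := (\int[mu]_y (majorant u c r x y)%:E)%E.

Let measurable_majorant_int c r : 0 < r ->
  measurable_fun setT (majorant_int c r).
Proof.
move=> r0; apply: (measurable_fun_fubini_tonelli_F (m2 := mu)
  (fun p => (majorant u c r p.1 p.2)%:E)) => [|p].
- exact: (measurable_majorant mu_u c r).
- by rewrite lee_fin majorant_ge0.
Qed.

Let majorant_int_ge0 c r x : 0 < r -> (0 <= majorant_int c r x)%E.
Proof. by move=> r0; apply: integral_ge0 => y _; rewrite lee_fin majorant_ge0. Qed.

(** The iterated integral of the majorant over the ball is finite, so its inner integral is finite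
    for almost every [x], and there it dominates the integrand. *)
Lemma ae_integrable_local c r : 0 < r ->
  {ae mu, forall x, vball c r x ->
     mu.-integrable setT (fun y => (transform_integrand c (2 * r) x y)%:E)}.
Proof.
move=> r0.
have : mu.-integrable (vball c r) (majorant_int c r).
  apply/integrableP; split; first by apply: measurable_funTS; exact: measurable_majorant_int.
  under eq_integral do rewrite gee0_abs ?majorant_int_ge0//.
  apply: le_lt_trans (integral_majorant_le n_gt0 M_gt0 u_ge0 mu_u int_phi c r0) _.
  by rewrite ltry.
move/(integrable_ae (measurable_vball c r)); apply: filterS => x fx xB.
apply: (@le_integrable _ _ _ mu setT measurableT _
  (fun y => (coord_form_bound a * majorant u c r x y)%:E)).
- by apply/measurable_EFinP; exact: measurable_transform_integrand_r.
- move=> y _; rewrite /= lee_fin [leRHS]ger0_norm ?transform_integrand_le//.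
  by rewrite mulr_ge0 ?coord_form_bound_ge0// majorant_ge0.
have mm : measurable_fun setT (fun y => (majorant u c r x y)%:E).
  exact: (measurableT_comp (measurable_majorant mu_u c r) (measurable_pair1 x)).
under eq_fun do rewrite EFinM.
apply: integrableZl => //; apply/integrableP; split => //.
rewrite (eq_integral (fun y => (majorant u c r x y)%:E)); last first.
  by move=> y _; rewrite gee0_abs// lee_fin majorant_ge0.
by rewrite -ge0_fin_numE ?fx//; exact: majorant_int_ge0.
Qed.

Lemma ae_integrable_transform :
  {ae mu, forall x,
     mu.-integrable setT (fun y => (transform_integrand vzero 1 x y)%:E)}.
Proof.
have loc (N : nat) : {ae mu, forall x, vball vzero N.+1%:R x ->
    mu.-integrable setT (fun y => (transform_integrand vzero 1 x y)%:E)}.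
  have N0 : 0 < N.+1%:R :> R by rewrite ltr0n.
  have := ae_integrable_local vzero N0; apply: filterS => x ix xB.
  have mT rho := measurable_transform_integrand_r vzero rho x.
  (* The two normalizations differ only for [1 <= |y| < 2 * (N + 1)], where the kernel is at most
     [1]; so [h] is controlled by the integral of [u] over a ball. *)
  pose h y := transform_integrand vzero 1 x y -
              transform_integrand vzero (2 * N.+1%:R) x y.
  suff ih : mu.-integrable setT (EFin \o h).
    rewrite (_ : (fun y => _) = fun y =>
      ((EFin \o h) y + (transform_integrand vzero (2 * N.+1%:R) x y)%:E)%E).
      by apply: integrableD => //; exact: ix.
    by apply/funext => y; rewrite /= -EFinD subrK.
  apply: (@le_integrable _ _ _ mu setT measurableT _
    (fun y => (coord_form_bound a * (\1_(vball vzero (2 * N.+1%:R)) y * u y))%:E)).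
  - by apply/measurable_EFinP; exact: measurable_funB.
  - move=> y _; rewrite /= lee_fin [leRHS]ger0_norm; last first.
      by rewrite mulr_ge0 ?coord_form_bound_ge0// mulr_ge0.
    rewrite /h /transform_integrand -coord_formB vsub_sub2l; apply: coord_form_le => i.
    rewrite tnth_vsub [X in X - _]tnth_vscale [X in _ - X]tnth_vscale.
    rewrite vsubx0 -mulrBl normrM !indicE !in_setC.
    have [yN|yN] := boolP (y \in vball vzero (2 * N.+1%:R)).
      have [y1|y1] := boolP (y \in vball vzero 1); first by rewrite subrr normr0 mul0r.
      rewrite sub0r normrN normr1 mul1r; apply: le_trans (cauchy_kernel_le _ _) _.
      rewrite -/(riesz_kernel y) -(expr1n R n.-1) -[X in _ <= X ^+ _]invr1.
      apply: (riesz_kernel_le n_gt0 ltr01).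
      by rewrite leNgt; apply: contra y1 => ?; rewrite inE /vball/= vsubx0.
    have [y1|y1] := boolP (y \in vball vzero 1); last by rewrite subrr normr0 mul0r.
    move: y1 yN; rewrite inE notin_setE /vball/= => y1 /negP; rewrite -leNgt => yN.
    have : 1 <= N.+1%:R :> R by rewrite ler1n.
    by lra.
  under eq_fun do rewrite EFinM.
  have mu1 : measurable_fun setT (fun y => (\1_(vball vzero (2 * N.+1%:R)) y * u y)%:E).
    apply/measurable_EFinP; apply: measurable_funM => //.
    by apply: measurable_indic; exact: measurable_vball.
  apply: integrableZl => //; apply/integrableP; split => //.
  have N2 : 0 < 2 * N.+1%:R :> R by rewrite mulr_gt0.
  apply: le_lt_trans (le_lt_trans
    (integral_vball_le n_gt0 M_gt0 u_ge0 mu_u int_phi vzero N2) (ltry _)).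
  rewrite [leRHS]integral_mkcond le_eqVlt; apply/orP; left; apply/eqP.
  apply: eq_integral => y _; rewrite gee0_abs ?lee_fin ?mulr_ge0// patchE indicE.
  by case: ifPn => _; rewrite ?mul1r ?mul0r.
(* The countably many exceptional sets have a null union, and every [x] lies in the ball indexed by
   an integer above its norm. *)
have := @ae_foralln _ _ _ mu _ loc; apply: filterS => x /(_ (Num.bound (vnorm x))).
apply; rewrite /vball/= vsubx0 (lt_trans (archi_boundP (vnorm_ge0 x)))//.
by rewrite ltr_nat.
Qed.

(** Measurability must hold at every [x], including those where the integral diverges. It is
    obtained in the extended reals from Tonelli for the positive and negative parts; [fine] then
    fixes the default value. *)
Lemma measurable_renormalized_transform c rho :
  measurable_fun setT (renormalized_transform c rho).
Proof.
pose f (p : euclidean R n * euclidean R n) := (transform_integrand c rho p.1 p.2)%:E.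
have mf : measurable_fun setT f.
  by apply/measurable_EFinP; exact: measurable_transform_integrand.
apply: (measurableT_comp (fine_measurable measurableT)).
under eq_fun do rewrite integralE.
rewrite (_ : (fun x => _) =
    (fun x => fubini_F mu (f^\+)%E x - fubini_F mu (f^\-)%E x)%E).
  apply: emeasurable_funB.
    exact: measurable_fun_fubini_tonelli_F (measurable_funepos mf) (funepos_ge0 f).
  exact: measurable_fun_fubini_tonelli_F (measurable_funeneg mf) (funeneg_ge0 f).
apply/funext => x; congr (_ - _)%E; apply: eq_integral => y _.
  by rewrite !funeposE.
by rewrite !funenegE.
Qed.

Lemma renormalized_transform_osc c r : 0 < r -> exists b : R,
  (\int[mu]_(x in vball c r) `|renormalized_transform vzero 1 x - b|%:E
   <= (coord_form_bound a * (@majorant_const R n * r ^+ n * M))%:E)%E.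
Proof.
(* [h] is the change of normalization evaluated at [x = c]; by [transform_integrandB] any other
   point gives the same function, so its integral is the constant sought. *)
move=> r0; pose h y := transform_integrand vzero 1 c y -
                       transform_integrand c (2 * r) c y.
exists (\int[mu]_y h y).
apply: (@le_trans _ _ (\int[mu]_(x in vball c r)
    ((coord_form_bound a)%:E * majorant_int c r x))%E); last first.
  rewrite ge0_integralZl_EFin ?coord_form_bound_ge0//; last 3 first.
  - exact: measurable_vball.
  - by move=> x _; exact: majorant_int_ge0.
  - by apply: measurable_funTS; exact: measurable_majorant_int.
  rewrite [leRHS]EFinM lee_wpmul2l ?lee_fin ?coord_form_bound_ge0//.
  exact: (integral_majorant_le n_gt0 M_gt0 u_ge0 mu_u int_phi c r0).
have mT := measurable_renormalized_transform vzero 1.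
(* Splitting off the constant needs both normalized integrands to be integrable in [y], which is
   known only for almost every [x]. *)
apply: ae_ge0_le_integral.
- exact: measurable_vball.
- by [].
- apply/measurable_EFinP; apply: measurableT_comp => //.
  by apply: measurable_funTS; exact: measurable_funB.
- by move=> x _; rewrite mule_ge0 ?majorant_int_ge0// lee_fin coord_form_bound_ge0.
- by apply: measurable_funeM; apply: measurable_funTS; exact: measurable_majorant_int.
have := ae_integrable_local c r0; have := ae_integrable_transform.
apply: filterS2 => x ix iloc xB; have {}iloc := iloc xB.
have -> : renormalized_transform vzero 1 x - \int[mu]_y h y =
    \int[mu]_y transform_integrand c (2 * r) x y.
  have -> : \int[mu]_y h y = \int[mu]_y
      (transform_integrand vzero 1 x y - transform_integrand c (2 * r) x y).
    by apply: eq_Rintegral => y _; exact: transform_integrandB.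
  by rewrite RintegralB// opprB addrC subrK.
rewrite EFin_normr_Rintegral//.
have mm : measurable_fun setT (fun y => (majorant u c r x y)%:E).
  exact: (measurableT_comp (measurable_majorant mu_u c r) (measurable_pair1 x)).
have mi : measurable_fun setT (fun y => (transform_integrand c (2 * r) x y)%:E).
  by apply/measurable_EFinP; exact: measurable_transform_integrand_r.
apply: le_trans (le_abse_integral _ measurableT mi) _.
rewrite -ge0_integralZl_EFin ?coord_form_bound_ge0//; last first.
  by move=> y _; rewrite lee_fin majorant_ge0.
apply: ge0_le_integral => //.
- exact: measurableT_comp.
- exact: measurable_funeM.
by move=> y _; rewrite -EFinM lee_fin transform_integrand_le.
Qed.

End renormalized_transform.

(** * The exterior algebra products in coordinates *)

Section exterior_coefficients.
Context {R : realType} {n : nat}.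
Implicit Types (S T U : {set 'I_n}) (v : euclidean R n) (w : multivector R n).

(* The coefficient of [v_i * w_T] in the [S]-coordinate of [v /\ w]. *)
Definition wedge_coef S (i : 'I_n) T : R :=
  \sum_(U : {set 'I_n} | U \subset S)
    shuffle_sign U (S :\: U) * ((U == finset.set1 i) && (S :\: U == T))%:R.

(** [mv_of_vec v] lives on singletons, so only the splittings of [S] into a singleton and its
    complement survive. *)
Lemma wedge_mv_of_vecE v w S :
  wedge (mv_of_vec v) w S = coord_form (wedge_coef S) v w.
Proof.
rewrite ffunE /coord_form.
under [RHS]eq_bigr => i _.
  under eq_bigr => T _ do rewrite mulr_suml.
  rewrite exchange_big/=; over.
rewrite exchange_big/=; apply: eq_bigr => U _.
rewrite ffunE -mulrA [in LHS]mulr_suml mulr_sumr [in LHS]big_mkcond/=.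
apply: eq_bigr => i _; case: ifPn => [/eqP ->|/negbTE Ui].
  rewrite (bigD1 (S :\: finset.set1 i))//= big1 ?addr0 ?eqxx ?mulr1// => T TS.
  by rewrite eq_sym (negbTE TS) mulr0 mul0r.
by rewrite big1// => T _; rewrite andFb mulr0 mul0r.
Qed.

(** The interior product by [v] is the transpose of the exterior one, hence the exchange of the
    index sets in [wedge_coef]. *)
Lemma interiorE v w S :
  Defs.interior v w S = coord_form (fun i T => wedge_coef T i S) v w.
Proof.
rewrite ffunE /mv_inner /coord_form exchange_big/=; apply: eq_bigr => T _.
rewrite wedge_mv_of_vecE mulr_sumr; apply: eq_bigr => i _.
rewrite (bigD1 S)//= big1 ?addr0 => [|T' /negbTE TS]; last first.
  by rewrite ffunE TS !mulr0.
by rewrite ffunE eqxx mulr1; ring.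
Qed.

Lemma coord_formD (a b : 'I_n -> {set 'I_n} -> R) v w :
  coord_form (fun i T => a i T + b i T) v w = coord_form a v w + coord_form b v w.
Proof.
rewrite /coord_form -big_split/=; apply: eq_bigr => i _; rewrite -big_split/=.
by apply: eq_bigr => T _; rewrite mulrDl.
Qed.

Lemma coord_formN (a : 'I_n -> {set 'I_n} -> R) v w :
  coord_form (fun i T => - a i T) v w = - coord_form a v w.
Proof.
rewrite /coord_form -sumrN; apply: eq_bigr => i _; rewrite -sumrN.
by apply: eq_bigr => T _; rewrite mulNr.
Qed.

Lemma coord_form_vsubC (a : 'I_n -> {set 'I_n} -> R) v1 v2 w :
  coord_form a (vsub v1 v2) w = - coord_form a (vsub v2 v1) w.
Proof. by rewrite !coord_formB opprB. Qed.

Lemma vtriangleE v w S : vtriangle v w S =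
  coord_form (fun i T => wedge_coef T i S + wedge_coef S i T) v w.
Proof. by rewrite ffunE interiorE wedge_mv_of_vecE coord_formD. Qed.

Lemma vtriangledownE v w S : vtriangledown v w S =
  coord_form (fun i T => - wedge_coef T i S + wedge_coef S i T) v w.
Proof.
rewrite ffunE [X in X + _]ffunE interiorE wedge_mv_of_vecE.
by rewrite coord_formD coord_formN.
Qed.

Lemma cauchy_kernel_vsubC (x y : euclidean R n) i :
  tnth (cauchy_kernel (vsub x y)) i = - tnth (cauchy_kernel (vsub y x)) i :> R.
Proof. by rewrite !tnth_vscale vdistC !tnth_vsub -mulrN opprB. Qed.

Definition cauchy_plus_coef S (i : 'I_n) T : R := wedge_coef T i S + wedge_coef S i T.

(* The outer sign turns the kernel [K(x - y)] of C^- into [K(y - x)]. *)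
Definition cauchy_minus_coef S (i : 'I_n) T : R :=
  - (- wedge_coef T i S + wedge_coef S i T).

Lemma cauchy_plus_integrandE (phi : euclidean R n -> multivector R n) x y S :
  cauchy_plus_integrand phi x y S =
  transform_integrand (cauchy_plus_coef S) phi vzero 1 x y.
Proof.
by rewrite /cauchy_plus_integrand vtriangleE /transform_integrand
  /renormalized_kernel vsubx0.
Qed.

Lemma cauchy_minus_integrandE (phi : euclidean R n -> multivector R n) x y S :
  cauchy_minus_integrand phi x y S =
  transform_integrand (cauchy_minus_coef S) phi vzero 1 x y.
Proof.
rewrite /cauchy_minus_integrand vtriangledownE /transform_integrand coord_formN.
rewrite /renormalized_kernel -coord_form_vsubC; congr (coord_form _ _ _).
apply: eq_from_tnth => i; rewrite !tnth_vsub ![tnth (vscale _ (cauchy_kernel _)) i]tnth_vscale.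
by rewrite (cauchy_kernel_vsubC x y) (cauchy_kernel_vsubC vzero y) mulrN opprK addrC.
Qed.

End exterior_coefficients.

(** * From coordinates to the BMO norm *)

Section bmo_bound.
Context {R : realType} {n : nat}.
Hypothesis n_gt0 : (0 < n)%N.
Local Notation mu := (lebesgue_measure_n R n).
Variables (a : {set 'I_n} -> 'I_n -> {set 'I_n} -> R) (s : R).
Implicit Type phi : euclidean R n -> multivector R n.

Definition mv_transform phi (x : euclidean R n) : multivector R n :=
  [ffun S => s * renormalized_transform (a S) phi vzero 1 x].

(** The [2] pays for passing to the mean, the sum over [S] for bounding [mv_norm] by coordinates,
    and [(n / 2) ^ n] is [r ^ n] divided by the volume [(2 * r / n) ^ n] of the inscribed cube. *)
Definition bmo_const : R :=
  (\sum_S 2 * (`|s| * (coord_form_bound (a S) * @majorant_const R n))) *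
  (n%:R / 2) ^+ n.

Let majorant_const_ge0 : 0 <= @majorant_const R n.
Proof. by rewrite addr_ge0// !mulr_ge0 ?addr_ge0 ?exprn_ge0// divr_ge0. Qed.

Lemma bmo_const_ge0 : 0 <= bmo_const.
Proof.
rewrite mulr_ge0 ?exprn_ge0 ?divr_ge0//; apply: sumr_ge0 => S _.
by rewrite !mulr_ge0 ?coord_form_bound_ge0.
Qed.

Section fixed_bound.
Variables (phi : euclidean R n -> multivector R n) (M : R).
Hypothesis M_gt0 : 0 < M.
Hypothesis mphi : forall T, measurable_fun setT (fun y => phi y T).
Hypothesis int_phi : (\int[mu]_y (mv_norm (phi y) ^+ n)%:E <= (M ^+ n)%:E)%E.

Let measurable_mv_transform S : measurable_fun setT (fun x => mv_transform phi x S).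
Proof.
under eq_fun do rewrite ffunE.
by apply: measurable_funM => //; exact: measurable_renormalized_transform.
Qed.

Let mv_transform_osc S c r : 0 < r -> exists b : R,
  (\int[mu]_(x in vball c r) `|mv_transform phi x S - b|%:E <=
   (`|s| * (coord_form_bound (a S) * (@majorant_const R n * r ^+ n * M)))%:E)%E.
Proof.
move=> r0.
have [b bP] := renormalized_transform_osc n_gt0 (a S) M_gt0 mphi int_phi c r0.
exists (s * b).
rewrite (eq_integral (fun x =>
  (`|s|%:E * `|renormalized_transform (a S) phi vzero 1 x - b|%:E)%E)); last first.
  by move=> x _; rewrite ffunE -mulrBr normrM EFinM.
rewrite ge0_integralZl_EFin//; last 2 first.
- exact: measurable_vball.
- apply/measurable_EFinP; apply: measurableT_comp => //; apply: measurable_funTS.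
  by apply: measurable_funB => //; exact: measurable_renormalized_transform.
by rewrite [leRHS]EFinM lee_wpmul2l.
Qed.

Lemma mv_integrable_mv_transform c r : mv_integrable (vball c r) (mv_transform phi).
Proof.
(* Integrability is asked for every real radius, the oscillation bound for positive ones; the ball
   of radius [|r| + 1] contains the given one. *)
move=> S; have r0 : 0 < `|r| + 1 by rewrite ltr_wpDl.
have [b bP] := mv_transform_osc S c r0.
have := integrable_of_dist (measurable_vball c _)
  (lebesgue_vball_fin c (ltW r0)) (measurable_mv_transform S) bP.
apply: integrableS; [exact: measurable_vball|exact: measurable_vball|].
move=> y; rewrite /vball/= => /lt_le_trans; apply.
by rewrite (le_trans (ler_norm r))// lerDl.
Qed.

Lemma BMO_norm_mv_transform_le : (BMO_norm (mv_transform phi) <= (bmo_const * M)%:E)%E.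
Proof.
apply: ge_ereal_sup => _ [c _ [r /= r0 <-]].
set B := vball c r.
have mB : measurable B by exact: measurable_vball.
have muBfin : mu B \is a fin_num by apply: lebesgue_vball_fin; exact: ltW.
have nR : 0 < n%:R :> R by rewrite ltr0n.
have low : (2 * (r / n%:R)) ^+ n <= fine (mu B).
  by rewrite -lee_fin fineK//; exact: lebesgue_vball_ge.
have low0 : 0 < (2 * (r / n%:R)) ^+ n by rewrite exprn_gt0// mulr_gt0// divr_gt0.
have muB0 : 0 < fine (mu B) by exact: lt_le_trans low.
pose osc S x := `|mv_transform phi x S -
  (fine (mu B))^-1 * (\int[mu]_(x in B) mv_transform phi x S)|.
have mosc S : measurable_fun B (fun x => (osc S x)%:E).
  apply/measurable_EFinP; apply: measurableT_comp => //; apply: measurable_funTS.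
  exact: measurable_funB.
pose K S := 2 * (`|s| * (coord_form_bound (a S) * (@majorant_const R n * r ^+ n * M))).
have oscK S : (\int[mu]_(x in B) (osc S x)%:E <= (K S)%:E)%E.
  have [b bP] := mv_transform_osc S c r0.
  exact: (mean_oscillation_le mB muBfin (measurable_mv_transform S) bP muB0).
have K0 S : 0 <= K S.
  rewrite mulr_ge0// mulr_ge0// mulr_ge0 ?coord_form_bound_ge0//.
  by rewrite !mulr_ge0 ?exprn_ge0// ltW.
have tot : (\int[mu]_(x in B) (mv_norm (mv_transform phi x - mean B (mv_transform phi)))%:E
    <= (\sum_S K S)%:E)%E.
  apply: (@le_trans _ _ (\int[mu]_(x in B) \sum_S (osc S x)%:E)%E).
    apply: ge0_le_integral => //.
    - by move=> x _; rewrite lee_fin mv_norm_ge0.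
    - apply/measurable_EFinP; apply: measurable_funTS; apply: measurable_mv_norm => T.
      under eq_fun do rewrite ffunE [X in _ + X]ffunE.
      by apply: measurable_funD.
    - by apply: emeasurable_sum.
    move=> x _; rewrite sumEFin lee_fin; apply: le_trans (mv_norm_le_sum _) _.
    by apply: ler_sum => S _; rewrite /osc !ffunE.
  rewrite ge0_integral_sum//; last by move=> S x _; rewrite lee_fin normr_ge0.
  rewrite -sumEFin.
  by apply: lee_sum => S _; exact: oscK.
apply: (@le_trans _ _ ((((2 * (r / n%:R)) ^+ n)^-1)%:E * (\sum_S K S)%:E)%E).
  apply: lee_pmul => //.
  - by rewrite lee_fin invr_ge0 ltW.
  - by apply: integral_ge0 => x _; rewrite lee_fin mv_norm_ge0.
  - by rewrite lee_fin lef_pV2 ?posrE.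
rewrite -EFinM lee_fin /bmo_const.
have -> : \sum_S K S = (\sum_S 2 * (`|s| * (coord_form_bound (a S) * @majorant_const R n)))
    * (r ^+ n * M).
  by rewrite mulr_suml; apply: eq_bigr => S _; rewrite /K; ring.
rewrite mulrCA -!mulrA ler_wpM2l//.
  by apply: sumr_ge0 => S _; rewrite !mulr_ge0 ?coord_form_bound_ge0.
rewrite le_eqVlt; apply/orP; left; apply/eqP.
rewrite [LHS]mulrA; congr (_ * M); rewrite -exprVn -exprMn; congr (_ ^+ n).
by field; rewrite !gt_eqF.
Qed.

End fixed_bound.

Lemma mv_transform_BMO phi : in_Lp n%:R%:E phi ->
  [/\ {ae mu, forall x S, mu.-integrable setT
        (fun y => (transform_integrand (a S) phi vzero 1 x y)%:E)},
      in_BMO (mv_transform phi) &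
      (BMO_norm (mv_transform phi) <= bmo_const%:E * Lp_norm n%:R%:E phi)%E].
Proof.
move=> [mphi Nfin]; set N := Lp_norm _ _ in Nfin *.
have N0 : (0 <= N)%E by exact: Lnorm_ge0.
have NE : N = (fine N)%:E by rewrite fineK// ge0_fin_numE.
have fN0 : 0 <= fine N by rewrite fine_ge0.
have intN : (\int[mu]_y (mv_norm (phi y) ^+ n)%:E)%E = (fine N ^+ n)%:E.
  rewrite -powR_mulrn// -poweR_EFin -NE /N /Lp_norm poweR_Lnorm; last first.
    by rewrite pnatr_eq0 -lt0n.
  apply: eq_integral => y _.
  by rewrite /= ger0_norm ?mv_norm_ge0// powR_mulrn ?mv_norm_ge0.
(* [N] may be [0] while the estimates need a positive [M]: they are applied with [M = N + e]. The
   limit [e -> 0] is taken only in the norm inequality; the other two claims use [e = 1]. *)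
have intM (e : R) : 0 < e ->
    (\int[mu]_y (mv_norm (phi y) ^+ n)%:E <= ((fine N + e) ^+ n)%:E)%E.
  move=> e0; rewrite intN lee_fin lerXn2r ?nnegrE ?addr_ge0 ?(ltW e0)//.
  by rewrite lerDl ltW.
have M0 (e : R) : 0 < e -> 0 < fine N + e by move=> e0; rewrite ltr_wpDl.
have bmo : (BMO_norm (mv_transform phi) <= bmo_const%:E * N)%E.
  apply/lee_addgt0Pr => e e0.
  (* The excess becomes [bmo_const * e / (bmo_const + 1) <= e]; the added [1] keeps the denominator
     positive. *)
  have e1 : 0 < e / (bmo_const + 1) by rewrite divr_gt0// ltr_wpDl// bmo_const_ge0.
  apply: le_trans (BMO_norm_mv_transform_le (M0 _ e1) mphi (intM _ e1)) _.
  rewrite NE -EFinM -EFinD lee_fin mulrDr lerD2l mulrCA ger_pMr//.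
  by rewrite ler_pdivrMr ?ltr_wpDl ?bmo_const_ge0// mul1r lerDl.
split => //.
- apply: filter_forall => S.
  exact: (ae_integrable_transform n_gt0 (a S) (M0 _ ltr01) mphi (intM _ ltr01)).
- split; first by move=> c r;
    exact: (mv_integrable_mv_transform (M0 _ ltr01) mphi (intM _ ltr01)).
  by rewrite (le_lt_trans bmo)// NE -EFinM ltry.
Qed.

End bmo_bound.

Theorem proposition7p2 (R : realType) (n : nat) (n_gt0 : (0 < n)%N) :
  exists Cplus Cminus : R,
    forall phi : euclidean R n -> multivector R n,
      in_Lp n%:R%:E phi ->
      [/\ {ae lebesgue_measure_n R n, forall x,
             mv_integrable setT (cauchy_plus_integrand phi x)},
          in_BMO (cauchy_plus phi) &
          (BMO_norm (cauchy_plus phi) <= Cplus%:E * Lp_norm n%:R%:E phi)%E] /\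
      [/\ {ae lebesgue_measure_n R n, forall x,
             mv_integrable setT (cauchy_minus_integrand phi x)},
          in_BMO (cauchy_minus phi) &
          (BMO_norm (cauchy_minus phi) <= Cminus%:E * Lp_norm n%:R%:E phi)%E].
Proof.
pose sigma : R := (sphere_area (R := R) (n := n))^-1.
exists (bmo_const (n := n) cauchy_plus_coef sigma), (bmo_const (n := n) cauchy_minus_coef sigma).
move=> phi Lphi.
have plusE : cauchy_plus phi = mv_transform cauchy_plus_coef sigma phi.
  apply/funext => x; apply/ffunP => S; rewrite !ffunE; congr (_ * _).
  by apply: eq_Rintegral => y _; exact: cauchy_plus_integrandE.
have minusE : cauchy_minus phi = mv_transform cauchy_minus_coef sigma phi.
  apply/funext => x; apply/ffunP => S; rewrite !ffunE; congr (_ * _).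
  by apply: eq_Rintegral => y _; exact: cauchy_minus_integrandE.
rewrite plusE minusE; split.
  have [ae_int ? ?] := mv_transform_BMO n_gt0 cauchy_plus_coef sigma Lphi.
  split=> //; apply: filterS ae_int => x ix S.
  by under eq_fun do rewrite cauchy_plus_integrandE; exact: ix.
have [ae_int ? ?] := mv_transform_BMO n_gt0 cauchy_minus_coef sigma Lphi.
split=> //; apply: filterS ae_int => x ix S.
by under eq_fun do rewrite cauchy_minus_integrandE; exact: ix.
Qed.
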